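(* Let $Z\sim\mathcal{N}(0,I_d)$ be a standard Gaussian random vector in $\mathbb{R}^d$, let $G\sim\mathcal{N}(\mu,\Lambda)$ be any Gaussian random vector in $\mathbb{R}^d$ with diagonal covariance matrix $\Lambda$, independent of $Z$, and let $T:\mathbb{R}^d\to\mathbb{R}^d$ be any strong contraction. Then $$N(G+Z)\ge N(T(G)+Z)+\bigl(1-\mathrm{Lip}^2(T)\bigr)N(G).$$ If, in addition, $\Lambda=\alpha I_d$ for some $\alpha>0$, the inequality holds for any contraction $T:\mathbb{R}^d\to\mathbb{R}^d$.
   Context: A contraction is a $1$-Lipschitz map for the Euclidean norm; $\mathrm{Lip}(T)$ is the Lipschitz constant of $T$ for the Euclidean norm. A map $T=(T_1,\dots,T_d):\mathbb{R}^d\to\mathbb{R}^d$ is a strong contraction if $|T_i(x)-T_i(y)|\le|x_i-y_i|$ for all $i=1,\dots,d$ and all $x,y\in\mathbb{R}^d$. For a random vector $Y$ in $\mathbb{R}^d$ with density $f$, $h(Y)=-\int f\log f$ is the Shannon–Boltzmann entropy (natural logarithm) and $N(Y)=e^{2h(Y)/d}$ is the entropy power. *)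

(* Defs.v *)
From HB Require Import structures.
From mathcomp Require Import all_boot all_order all_algebra.
From mathcomp Require Import all_classical all_reals all_analysis.

Set Implicit Arguments.
Unset Strict Implicit.
Unset Printing Implicit Defensive.

Import Order.TTheory GRing.Theory Num.Theory.
Import numFieldNormedType.Exports.

Local Open Scope classical_set_scope.
Local Open Scope ring_scope.

Definition measure_rV_display : measure_display -> measure_display.
Proof. exact. Qed.

(* The product sigma-algebra on row vectors (for 'rV[R]_n, the Borel one): same
   construction as the library's for n.-tuple, but on a type which carries the
   linear structure. *)
Section measurable_rV.
Context {d} {T : measurableType d}.
Variable n : nat.

Let coors : 'I_n -> 'rV[T]_n -> T := fun i x => x ord0 i.

Let rV_set0 : g_sigma_preimage coors set0.
Proof. exact: sigma_algebra0. Qed.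

Let rV_setC A : g_sigma_preimage coors A -> g_sigma_preimage coors (~` A).
Proof. exact: sigma_algebraC. Qed.

Let rV_bigcup (F : _^nat) : (forall i, g_sigma_preimage coors (F i)) ->
  g_sigma_preimage coors (\bigcup_i (F i)).
Proof. exact: sigma_algebra_bigcup. Qed.

HB.instance Definition _ := @isMeasurable.Build (measure_rV_display d)
  'rV[T]_n (g_sigma_preimage coors) rV_set0 rV_setC rV_bigcup.

End measurable_rV.

Lemma measurable_coord d (T : measurableType d) n (i : 'I_n) :
  measurable_fun [set: 'rV[T]_n] (fun x : 'rV[T]_n => x ord0 i).
Proof.
move=> _ Y mY; rewrite setTI; apply: sub_sigma_algebra => /=.
rewrite -bigcup_seq/=; exists i => /=; first by rewrite mem_index_enum.
by exists Y => //; rewrite setTI.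
Qed.

Lemma measurable_fun_rVP d1 d2 (T1 : measurableType d1) (T2 : measurableType d2)
    n (f : T1 -> 'rV[T2]_n) :
  measurable_fun [set: T1] f <->
  forall i, measurable_fun [set: T1] (fun x => f x ord0 i).
Proof.
split=> [mf i|mf].
  exact: (measurableT_comp (measurable_coord i) mf).
have mG : g_sigma_preimage (fun i x => f x ord0 i) `<=` measurable.
  apply: smallest_sub; first exact: sigma_algebra_measurable.
  rewrite -bigcup_seq/=; apply: bigcup_sub => i _.
  by move=> A [B mB <-]; exact: mf.
move: mG; rewrite (g_sigma_preimage_comp (fun i (x : 'rV[T2]_n) => x ord0 i) f).
by move=> mG _ A mA; apply: mG; exists A.
Qed.

Section lebesgue_rV.
Context {R : realType}.

Definition rV_cons n (p : measurableTypeR R * 'rV[R]_n) : 'rV[R]_n.+1 :=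
  row_mx (p.1)%:M p.2.

Definition rV_uncons n (x : 'rV[R]_n.+1) : measurableTypeR R * 'rV[R]_n :=
  (x ord0 ord0, \row_i x ord0 (lift ord0 i)).

Lemma rV_cons0 n p : @rV_cons n p ord0 ord0 = p.1.
Proof.
rewrite /rV_cons (_ : ord0 = lshift n (ord0 : 'I_1)); last exact/val_inj.
by rewrite (@row_mxEl _ 1 1 n) !mxE eqxx.
Qed.

Lemma rV_consS n p i : @rV_cons n p ord0 (lift ord0 i) = p.2 ord0 i.
Proof.
by rewrite /rV_cons (_ : lift ord0 i = rshift 1 i) ?(@row_mxEr _ 1 1 n)//;
  exact/val_inj.
Qed.

Lemma rV_consK n : cancel (@rV_cons n) (@rV_uncons n).
Proof.
move=> [a x]; rewrite /rV_uncons rV_cons0; congr pair.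
by apply/rowP => i; rewrite mxE rV_consS.
Qed.

Lemma rV_unconsK n : cancel (@rV_uncons n) (@rV_cons n).
Proof.
move=> x; apply/rowP => i; have [j ->|->] := unliftP ord0 i.
  by rewrite rV_consS mxE.
by rewrite rV_cons0.
Qed.

Lemma measurable_rV_cons n : measurable_fun setT (@rV_cons n).
Proof.
apply/measurable_fun_rVP => i; have [j ->|->] := unliftP ord0 i.
  under eq_fun do rewrite rV_consS.
  exact: (measurableT_comp (measurable_coord j) measurable_snd).
under eq_fun do rewrite rV_cons0.
exact: measurable_fst.
Qed.

Lemma measurable_rV_uncons n : measurable_fun setT (@rV_uncons n).
Proof.
apply/measurable_fun_pairP; split; first exact: measurable_coord.
apply/measurable_fun_rVP => i.
under eq_fun do rewrite /= mxE.
exact: measurable_coord.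
Qed.

Section lebesgue_cons.
Variables (n : nat) (mu : {sigma_finite_measure set 'rV[R]_n -> \bar R}).

Definition lebesgue_cons : set 'rV[R]_n.+1 -> \bar R :=
  pushforward (lebesgue_measure \x mu)%E (@rV_cons n).

Let pushforward_measure :=
  measure_function_pushforward__canonical__measure_function_Measure
    (lebesgue_measure \x mu)%E (@measurable_rV_cons n).

Let lebesgue_cons0 : lebesgue_cons set0 = 0%E.
Proof. exact: (measure0 pushforward_measure). Qed.

Let lebesgue_cons_ge0 A : (0 <= lebesgue_cons A)%E.
Proof. exact: (measure_ge0 pushforward_measure). Qed.

Let lebesgue_cons_sigma_additive : semi_sigma_additive lebesgue_cons.
Proof. exact: (@measure_semi_sigma_additive _ _ _ pushforward_measure). Qed.

HB.instance Definition _ := isMeasure.Build _ _ _ lebesgue_cons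
  lebesgue_cons0 lebesgue_cons_ge0 lebesgue_cons_sigma_additive.

Let lebesgue_cons_sigma_finite : sigma_finite setT lebesgue_cons.
Proof.
have /sigma_finiteP[F [TF ndF Foo]] := sigma_finiteT (@lebesgue_measure R).
have /sigma_finiteP[G [TG ndG Goo]] := sigma_finiteT mu.
exists (fun k => @rV_uncons n @^-1` (F k `*` G k)).
  rewrite -preimage_bigcup (_ : \bigcup_k _ = setT) ?preimage_setT//.
  apply/seteqP; split=> // -[a x] _.
  have [k _ Fka] : (\bigcup_k F k) a by rewrite -TF.
  have [l _ Glx] : (\bigcup_k G k) x by rewrite -TG.
  exists (maxn k l) => //; split => /=.
    by move: a Fka; exact/subsetPset/ndF/leq_maxl.
  by move: x Glx; exact/subsetPset/ndG/leq_maxr.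
move=> k; have [mF Fk] := Foo k; have [mG Gk] := Goo k; split.
  rewrite -[X in measurable X]setTI.
  by apply: measurable_rV_uncons => //; exact: measurableX.
rewrite /lebesgue_cons /pushforward -comp_preimage.
rewrite (_ : _ \o _ = id); last by apply/funext => p; exact: rV_consK.
by rewrite preimage_id product_measure1E// lte_mul_pinfty// ge0_fin_numE.
Qed.

HB.instance Definition _ := Measure_isSigmaFinite.Build _ _ _ lebesgue_cons
  lebesgue_cons_sigma_finite.

End lebesgue_cons.

(* Lebesgue measure on R^n: the image of the n-fold product measure (R^0 being
   a point of mass 1). *)
Fixpoint lebesgue_rV n : {sigma_finite_measure set 'rV[R]_n -> \bar R} :=
  if n is m.+1 then lebesgue_cons (lebesgue_rV m) else dirac (0 : 'rV[R]_0).

Lemma lebesgue_rV_box n (A : 'I_n -> set (measurableTypeR R)) :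
  (forall i, measurable (A i)) ->
  lebesgue_rV n [set x | forall i, A i (x ord0 i)] =
  (\prod_(i < n) lebesgue_measure (A i))%E.
Proof.
elim: n A => [A _|n IHn A mA] /=.
  by rewrite big_ord0 diracE mem_set// => -[].
pose B := [set x : 'rV[R]_n | forall i, A (lift ord0 i) (x ord0 i)].
rewrite big_ord_recl -(IHn (fun i => A (lift ord0 i)))// -/B.
have mB : measurable B.
  rewrite (_ : B = \bigcap_(i in [set: 'I_n])
      ((fun x : 'rV[R]_n => x ord0 i) @^-1` A (lift ord0 i))).
    apply: fin_bigcap_measurable => // i _.
    rewrite -[X in measurable X]setTI.
    by apply: measurable_coord => //; exact: mA.
  by apply/seteqP; split=> x /= Bx i; [move=> _|]; exact: Bx.
rewrite -product_measure1E//.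
rewrite /lebesgue_cons /pushforward.
congr (_ _); apply/seteqP; split=> -[a x] /=.
  move=> Aax; split=> /= [|i]; first by have := Aax ord0; rewrite rV_cons0.
  by have := Aax (lift ord0 i); rewrite rV_consS.
move=> [/= Aa Ax] i; have [j ->|->] := unliftP ord0 i.
  by rewrite rV_consS; exact: Ax.
by rewrite rV_cons0.
Qed.

End lebesgue_rV.

Section euclidean.
Context {R : realType} {d : nat}.
Implicit Types (x y : 'rV[R]_d) (T : 'rV[R]_d -> 'rV[R]_d).

(* The library's norm `|x| on 'rV[R]_d is the sup norm. *)
Definition enorm x : R := Num.sqrt (\sum_(i < d) x ord0 i ^+ 2).

Definition elipschitz (k : R) T :=
  forall x y, enorm (T x - T y) <= k * enorm (x - y).

Definition Lip T : R := inf [set k | 0 <= k /\ elipschitz k T].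

Definition contraction_map T := elipschitz 1 T.

Definition strong_contraction T :=
  forall (i : 'I_d) x y, `|T x ord0 i - T y ord0 i| <= `|x ord0 i - y ord0 i|.

End euclidean.

Section random_vectors.
Context {disp : measure_display} {Omega : measurableType disp} {R : realType}.
Variable P : probability Omega R.
Context {d : nat}.
Implicit Types X Y : Omega -> 'rV[R]_d.

Definition independent X Y := forall A B : set 'rV[R]_d,
  measurable A -> measurable B ->
  (P (X @^-1` A `&` Y @^-1` B) = P (X @^-1` A) * P (Y @^-1` B))%E.

Definition psd_mx (S : 'M[R]_d) :=
  S^T = S /\ forall v : 'rV[R]_d, 0 <= (v *m S *m v^T) ord0 ord0.

Definition std_gauss_pdf (w : 'rV[R]_d) : R :=
  (Num.sqrt (2 * pi)) ^- d * expR (- (enorm w ^+ 2) / 2).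

(* X ~ N(mu, Sigma): X has the law of mu + Sigma^(1/2) W with W standard
   Gaussian, where Sigma^(1/2) is the positive semidefinite square root of
   Sigma. The covariance matrix Sigma may be singular. *)
Definition gaussian_vector X (mu : 'rV[R]_d) (Sigma : 'M[R]_d) :=
  exists S : 'M[R]_d, [/\ psd_mx S, S *m S = Sigma &
    forall A : set 'rV[R]_d, measurable A -> P (X @^-1` A) =
      (\int[lebesgue_rV d]_(w in (fun w => mu + w *m S)%R @^-1` A)
         (std_gauss_pdf w)%:E)%E].

Definition has_density Y (f : 'rV[R]_d -> R) :=
  [/\ measurable_fun setT f, forall x, 0 <= f x &
    forall A : set 'rV[R]_d, measurable A ->
      P (Y @^-1` A) = (\int[lebesgue_rV d]_(x in A) (f x)%:E)%E].

(* h(Y) = - \int f log f for a density f of Y (any two densities agree almost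
   everywhere), with the usual convention h(Y) = -oo if Y has no density. *)
Definition entropy Y : \bar R :=
  if pselect (exists f, has_density Y f) is left Yf then
    let f := projT1 (cid Yf) in
    (- \int[lebesgue_rV d]_x (f x * ln (f x))%:E)%E
  else -oo%E.

Definition entropy_power Y : \bar R := expeR ((2 / d%:R)%:E * entropy Y)%E.

End random_vectors.

(* Main.v *)
(* Let [s_i ^ 2] be the variances of [G], [c = T mu] and [L = Lip T]. Since
   [T (G)_i - c_i] is controlled by [L |G_i - mu_i|] (coordinatewise if [T] is a
   strong contraction, after summing over [i] in the isotropic case), the second
   moments of [T (G) + Z - c] are at most [v_i = 1 + L ^ 2 s_i ^ 2], on average
   over [i] with weights [1 / v_i]. Gibbs' inequality against the Gaussian of
   mean [c] and variances [v_i] then bounds [N (T (G) + Z)] by [2 pi e] times the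
   geometric mean of the [v_i], whereas [N (G + Z)] and [N (G)] are [2 pi e] times
   the geometric means of [1 + s_i ^ 2] and [s_i ^ 2]. The claim follows from the
   superadditivity of the geometric mean (Minkowski), as
   [1 + s_i ^ 2 = v_i + (1 - L ^ 2) s_i ^ 2]. *)
Require Import Defs.
From HB Require Import structures.
From mathcomp Require Import all_boot all_order all_algebra.
From mathcomp Require Import all_classical all_reals all_analysis.
From mathcomp Require Import measurable_realfun ring lra.

Set Implicit Arguments.
Unset Strict Implicit.
Unset Printing Implicit Defensive.

Import Order.TTheory GRing.Theory Num.Theory.
Import numFieldNormedType.Exports.

Local Open Scope classical_set_scope.
Local Open Scope ring_scope.

(** The covariance may be singular, and then [G] has no density. So [G] is always treated as the
    image of a standard Gaussian under [w_i |-> mu_i + s_i w_i], a map that is never inverted, and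
    densities of sums come from [Z]. If some [s_i] is 0, the convention gives [N(G) = 0] and the
    claim becomes monotonicity of the geometric mean. Reaching these coordinates requires knowing
    that the positive semidefinite root in the definition of a Gaussian vector is itself diagonal.
    Only [N(G + Z)] has to be computed exactly: the other two powers stand on the smaller side with
    nonnegative coefficients, so upper bounds suffice. Gibbs' inequality allows any center, so
    [T mu] need not be the mean of [T (G) + Z]. The weights [1 / v_i] explain the two cases. When
    they differ, each coordinate must be controlled separately; when [Lambda] is scalar they are
    equal, and a Euclidean bound on the sum is enough. *)

(** * Integration against the image of a measure with density *)

Section density.
Local Open Scope ereal_scope.
Context d1 d2 (T1 : measurableType d1) (T2 : measurableType d2) (R : realType).
Variables (mu : {measure set T1 -> \bar R}) (nu : {measure set T2 -> \bar R}).
Variables (k : T1 -> T2) (f : T1 -> R).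
Hypothesis mk : measurable_fun setT k.
Hypothesis mf : measurable_fun setT f.
Hypothesis f_ge0 : forall x, (0 <= f x)%R.
Hypothesis nuE : forall A, measurable A ->
  nu A = \int[mu]_(x in k @^-1` A) (f x)%:E.

Import HBNNSimple.

Let mfE : measurable_fun setT (fun x => (f x)%:E : \bar R).
Proof. exact/measurable_EFinP. Qed.

Let nnsfun_integral_density (h : {nnsfun T2 >-> R}) :
  \int[nu]_y (h y)%:E = \int[mu]_x ((h (k x))%:E * (f x)%:E).
Proof.
have mind r : measurable_fun setT
    (fun x => (\1_(h @^-1` [set r]) (k x))%:E : \bar R).
  apply/measurable_EFinP/(measurableT_comp _ mk); apply: measurable_indic.
  exact: measurable_sfunP.
under eq_integral do rewrite fimfunE -fsumEFin//.
rewrite ge0_integral_fsum//; last 2 first.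
- by move=> r; exact/measurable_EFinP/measurable_funM.
- by move=> r y _; rewrite nnfun_muleindic_ge0.
transitivity (\int[mu]_x (\sum_(r \in range h)
    ((r * \1_(h @^-1` [set r]) (k x))%:E * (f x)%:E))); last first.
  apply: eq_integral => x _.
  rewrite -ge0_mule_fsuml => [|y]; last exact: nnfun_muleindic_ge0.
  by rewrite fsumEFin// -fimfunE.
rewrite ge0_integral_fsum//; last 2 first.
- move=> r; apply: emeasurable_funM => //.
  under eq_fun do rewrite EFinM.
  exact: emeasurable_funM.
- by move=> r x _; rewrite mule_ge0 ?lee_fin// -lee_fin nnfun_muleindic_ge0.
apply: eq_fsbigr => r rh.
rewrite integralZl_indic_nnsfun// integral_indic// setIT nuE//.
under [RHS]eq_integral do rewrite EFinM -muleA.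
rewrite ge0_integralZl//; last 3 first.
- exact: emeasurable_funM.
- by move=> x _; rewrite mule_ge0 ?lee_fin.
- by move: rh; rewrite inE => -[t _ <-]; rewrite lee_fin.
congr (_ * _); rewrite integral_mkcond; apply: eq_integral => x _.
by rewrite epatch_indic muleC.
Qed.

(** Monotone convergence extends the case of simple functions. It serves with [k = id] for a vector
    that has a density, and with [k] affine for a possibly singular Gaussian. *)
Lemma ge0_integral_density (F : T2 -> \bar R) : measurable_fun setT F ->
  (forall y, 0 <= F y) ->
  \int[nu]_y F y = \int[mu]_x (F (k x) * (f x)%:E).
Proof.
move=> mF F0; pose h := nnsfun_approx measurableT mF.
have Flim y : F y = lim ((EFin \o h n) y @[n --> \oo]).
  by apply/esym/cvg_lim => //; exact: cvg_nnsfun_approx.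
transitivity (lim (\int[nu]_y (EFin \o h n) y @[n --> \oo])).
  under eq_integral do rewrite Flim.
  apply: monotone_convergence => //.
  - by move=> n; exact/measurable_EFinP.
  - by move=> n y _; rewrite lee_fin.
  - by move=> y _ a b ab; rewrite lee_fin; exact/lefP/nd_nnsfun_approx.
transitivity (lim (\int[mu]_x ((h n (k x))%:E * (f x)%:E) @[n --> \oo])).
  by under eq_fun do rewrite nnsfun_integral_density.
rewrite -monotone_convergence//.
- apply: eq_integral => x _; apply/cvg_lim => //.
  apply: (@cvgeZr _ _ _ (fun n => (h n (k x))%:E) (F (k x)) (f x)%:E) => //.
  exact: cvg_nnsfun_approx.
- move=> n; apply: emeasurable_funM => //; apply/measurable_EFinP.
  exact: measurableT_comp.
- by move=> n x _; rewrite mule_ge0// lee_fin.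
- move=> x _ a b ab; rewrite lee_wpmul2r ?lee_fin//.
  exact/lefP/nd_nnsfun_approx.
Qed.

End density.

(** * Lebesgue integrals of nonnegative functions on row vectors *)

Section lebesgue_rV_integral.
Local Open Scope ereal_scope.
Context {R : realType}.

(** The image of Lebesgue measure under a translation agrees with it on half-open intervals, which
    determine it. *)
Lemma ge0_lebesgue_integralD (c : R) (F : R -> \bar R) :
  measurable_fun setT F -> (forall x, 0 <= F x) ->
  \int[lebesgue_measure]_x F (x + c)%R = \int[lebesgue_measure]_x F x.
Proof.
move=> mF F0.
pose sh := (fun x : measurableTypeR R => (x + c)%R : measurableTypeR R).
have msh : measurable_fun setT sh by exact: measurable_funD.
rewrite -[LHS](@ge0_integral_pushforward _ _ _ _ _ sh msh
  lebesgue_measure setT F)//.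
apply: eq_measure_integral => A mA _; apply/esym.
pose m := measure_function_pushforward__canonical__measure_function_Measure
  (@lebesgue_measure R) msh.
apply: (@lebesgue_measure_unique _ m) => //= _ [[a b]] _ <-.
rewrite /pushforward (_ : sh @^-1` _ = `](a - c)%R, (b - c)%R]%classic).
  rewrite !lebesgue_measure_itv/= !lte_fin ltrD2r.
  by case: ifP => // _; rewrite -!EFinB; congr EFin; lra.
by apply/seteqP; split=> x /=; rewrite !in_itv/= /sh; lra.
Qed.

Lemma ge0_lebesgue_integralN (F : R -> \bar R) :
  measurable_fun setT F -> (forall x, 0 <= F x) ->
  \int[lebesgue_measure]_x F (- x)%R = \int[lebesgue_measure]_x F x.
Proof.
move=> mF F0; pose opp := (-%R : measurableTypeR R -> measurableTypeR R).
have mopp : measurable_fun setT opp by exact: oppr_measurable.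
rewrite -[LHS](@ge0_integral_pushforward _ _ _ _ _ opp mopp
  lebesgue_measure setT F)//.
by apply: eq_measure_integral => A mA _; exact: lebesgue_measureN.
Qed.

Lemma ge0_integral_lebesgue_rVS n (F : 'rV[R]_n.+1 -> \bar R) :
  measurable_fun setT F -> (forall x, 0 <= F x) ->
  \int[lebesgue_rV n.+1]_x F x =
  \int[lebesgue_measure]_a \int[lebesgue_rV n]_x F (rV_cons (a, x)).
Proof.
move=> mF F0.
rewrite [LHS](@ge0_integral_pushforward _ _ _ _ _ _ (@measurable_rV_cons R n))//.
rewrite preimage_setT (fubini_tonelli1 (F \o @rV_cons R n))//=.
by apply: measurableT_comp => //; exact: measurable_rV_cons.
Qed.

Lemma measurable_rV_addr n (c : 'rV[R]_n) :
  measurable_fun setT (fun x : 'rV[R]_n => x + c)%R.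
Proof.
apply/measurable_fun_rVP => i; under eq_fun do rewrite mxE.
by apply: measurable_funD => //; exact: measurable_coord.
Qed.

Lemma rV_consD n (a c : R) (x y : 'rV[R]_n) :
  (rV_cons (a, x) + rV_cons (c, y) = rV_cons (a + c, x + y))%R.
Proof.
apply/rowP => i; rewrite mxE; have [j ->|->] := unliftP ord0 i.
  by rewrite !rV_consS mxE.
by rewrite !rV_cons0.
Qed.

Lemma measurable_rV_cons2 n (a : R) :
  measurable_fun setT (fun x : 'rV[R]_n => rV_cons (a, x)).
Proof.
apply: (measurableT_comp (@measurable_rV_cons R n)).
exact: measurable_pair1.
Qed.

Lemma ge0_lebesgue_rV_integralD n (c : 'rV[R]_n) (F : 'rV[R]_n -> \bar R) :
  measurable_fun setT F -> (forall x, 0 <= F x) ->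
  \int[lebesgue_rV n]_x F (x + c)%R = \int[lebesgue_rV n]_x F x.
Proof.
elim: n c F => [c F mF F0|n IHn c F mF F0].
  by apply: eq_integral => x _; rewrite thinmx0 [in RHS]thinmx0.
have mFc : measurable_fun setT (fun x : 'rV[R]_n.+1 => F (x + c)%R).
  by apply: (measurableT_comp mF); exact: measurable_rV_addr.
rewrite !ge0_integral_lebesgue_rVS//.
rewrite -[c]rV_unconsK; case: (rV_uncons c) => c0 c' /=.
under eq_integral => a _.
  under eq_integral do rewrite rV_consD.
  rewrite (IHn c' (fun x => F (rV_cons ((a + c0)%R, x))))//; last first.
    by apply: (measurableT_comp mF); exact: measurable_rV_cons2.
  over.
rewrite (@ge0_lebesgue_integralD c0
  (fun a => \int[lebesgue_rV n]_x F (rV_cons (a, x))))//.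
- apply: (measurable_fun_fubini_tonelli_F (F \o @rV_cons R n)) => //=.
  by apply: measurableT_comp => //; exact: measurable_rV_cons.
- by move=> a; exact: integral_ge0.
Qed.

Lemma measurable_rV_prod n (g : 'I_n -> R -> R) :
  (forall i, measurable_fun setT (g i)) ->
  measurable_fun setT (fun x : 'rV[R]_n => \prod_(i < n) g i (x ord0 i))%R.
Proof.
move=> mg; apply: measurable_prod => i _.
by apply: (measurableT_comp (mg i)); exact: measurable_coord.
Qed.

Lemma ge0_integral_lebesgue_rV_prod n (g : 'I_n -> R -> R) :
  (forall i, measurable_fun setT (g i)) -> (forall i t, (0 <= g i t)%R) ->
  \int[lebesgue_rV n]_x (\prod_(i < n) g i (x ord0 i))%:E =
  \prod_(i < n) \int[lebesgue_measure]_t (g i t)%:E.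
Proof.
elim: n g => [|n IHn] g mg g0.
  under eq_integral do rewrite big_ord0.
  by rewrite big_ord0 integral_dirac// diracT mul1e.
rewrite ge0_integral_lebesgue_rVS//; last 2 first.
- by apply/measurable_EFinP; apply: (@measurable_rV_prod n.+1 g).
- by move=> x; rewrite lee_fin prodr_ge0.
rewrite big_ord_recl -(IHn (fun i => g (lift ord0 i)))//.
have mP : measurable_fun setT (fun x : 'rV[R]_n =>
    (\prod_(i < n) g (lift ord0 i) (x ord0 i))%:E : \bar R).
  apply/measurable_EFinP.
  by apply: (@measurable_rV_prod n (fun i => g (lift ord0 i))).
have P0 (x : 'rV[R]_n) : 0 <= (\prod_(i < n) g (lift ord0 i) (x ord0 i))%:E.
  by rewrite lee_fin; apply: prodr_ge0 => i _.
rewrite -ge0_integralZr//; last 3 first.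
- by have /measurable_EFinP := mg ord0.
- by move=> t _; rewrite lee_fin.
- by apply: integral_ge0 => x _; exact: P0.
apply: eq_integral => t _; rewrite -ge0_integralZl ?lee_fin//.
apply: eq_integral => x _; rewrite big_ord_recl rV_cons0/= -EFinM.
by under eq_bigr do rewrite rV_consS.
Qed.

End lebesgue_rV_integral.

(** * One-dimensional Gaussian densities: convolution and second moments *)

Section gaussian_line.
Context {R : realType}.
Implicit Types (a m s t v x y : R).
Local Notation mu := (@lebesgue_measure R).

(** Parameterised by the variance, unlike [normal_pdf], because variances add under convolution. *)
Definition npdf m v x : R :=
  (Num.sqrt (2 * pi * v))^-1 * expR (- (x - m) ^+ 2 / (2 * v)).

Lemma npdf_gt0 m v x : 0 < v -> 0 < npdf m v x.
Proof.
by move=> v0; rewrite mulr_gt0 ?expR_gt0// invr_gt0 sqrtr_gt0 !mulr_gt0// pi_gt0.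
Qed.

Lemma npdf_ge0 m v x : 0 <= npdf m v x.
Proof. by rewrite mulr_ge0 ?expR_ge0// invr_ge0 sqrtr_ge0. Qed.

Lemma npdfE m v : 0 < v -> npdf m v = normal_pdf m (Num.sqrt v).
Proof.
move=> v0; rewrite normal_pdfE ?gt_eqF ?sqrtr_gt0//; apply/funext => x.
rewrite /npdf /normal_peak /normal_fun sqr_sqrtr ?ltW//.
by congr (_ ^-1 * expR (_ / _)); [congr Num.sqrt|]; ring.
Qed.

Lemma measurable_npdf m v : measurable_fun setT (npdf m v).
Proof.
apply: measurable_funM => //; apply: measurableT_comp => //.
apply: measurable_funM => //; apply: measurableT_comp => //.
by apply: measurable_funX; apply: measurable_funD.
Qed.

Lemma integral_npdf m v : 0 < v -> (\int[mu]_x (npdf m v x)%:E = 1)%E.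
Proof. by move=> v0; rewrite npdfE// integral_normal_pdf. Qed.

Lemma npdfN v x : npdf 0 v (- x) = npdf 0 v x.
Proof. by rewrite /npdf !subr0 sqrrN. Qed.

Lemma ln_npdf m v x : 0 < v ->
  ln (npdf m v x) = - (ln (2 * pi * v) + (x - m) ^+ 2 / v) / 2.
Proof.
move=> v0; have p0 : 0 < 2 * pi * v by rewrite !mulr_gt0 ?pi_gt0.
rewrite /npdf [LHS]lnM ?posrE ?expR_gt0 ?invr_gt0 ?sqrtr_gt0//.
rewrite expRK lnV ?posrE ?sqrtr_gt0//.
have -> : ln (2 * pi * v) = ln (Num.sqrt (2 * pi * v)) *+ 2.
  by rewrite -lnXn ?sqrtr_gt0// sqr_sqrtr// ltW.
by field; rewrite gt_eqF.
Qed.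

(* Completing the square: both sides are the joint density of [(t, y)]. *)
Lemma npdf_mul s t y : npdf 0 1 (y - s * t) * npdf 0 1 t =
  npdf 0 (1 + s ^+ 2) y * npdf (s * y / (1 + s ^+ 2)) (1 + s ^+ 2)^-1 t.
Proof.
have q0 : 0 < 1 + s ^+ 2 by rewrite ltr_wpDr// sqr_ge0.
have pi2 : 0 <= 2 * pi :> R by rewrite mulr_ge0 ?pi_ge0.
rewrite /npdf !subr0 mulrACA [RHS]mulrACA -!expRD; congr (_ * expR _); last first.
  by field; rewrite gt_eqF.
rewrite mulr1 !sqrtrM// sqrtrV ?ltW//.
have : Num.sqrt (1 + s ^+ 2) != 0 by rewrite gt_eqF ?sqrtr_gt0.
have : Num.sqrt pi != 0 :> R by rewrite gt_eqF ?sqrtr_gt0 ?pi_gt0.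
have : Num.sqrt 2 != 0 :> R by rewrite gt_eqF ?sqrtr_gt0.
by move=> ? ? ?; field; do !(apply/andP; split).
Qed.

(** In the completed square only the second factor depends on [t], and it integrates to 1. Scaling
    [t] by [s], instead of using a density of variance [s ^+ 2], keeps [s = 0] allowed. *)
Lemma npdf_conv s y :
  (\int[mu]_t (npdf 0 1 (y - s * t) * npdf 0 1 t)%:E =
   (npdf 0 (1 + s ^+ 2) y)%:E)%E.
Proof.
have q0 : 0 < 1 + s ^+ 2 by rewrite ltr_wpDr// sqr_ge0.
under eq_integral do rewrite npdf_mul EFinM.
rewrite ge0_integralZl_EFin ?npdf_ge0//.
- by rewrite integral_npdf ?mule1// invr_gt0.
- by move=> t _; rewrite lee_fin npdf_ge0.
- by apply/measurable_EFinP; exact: measurable_npdf.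
Qed.

Let M : \bar R := (\int[mu]_t (t ^+ 2 * npdf 0 1 t)%:E)%E.

Let mM : measurable_fun setT (fun t : R => t ^+ 2 * npdf 0 1 t).
Proof.
by apply: measurable_funM; [exact: measurable_funX|exact: measurable_npdf].
Qed.

Let M_ge0 : (0 <= M)%E.
Proof.
by apply: integral_ge0 => t _; rewrite lee_fin mulr_ge0 ?sqr_ge0 ?npdf_ge0.
Qed.

(* Integrating this tangent inequality of [exp] for [v] close to 1, on either
   side, pins down the second moment. *)
Let npdf_tangent v t : 0 < v ->
  npdf 0 1 t + (1 - v^-1) / 2 * (t ^+ 2 * npdf 0 1 t) <=
  Num.sqrt v * npdf 0 v t.
Proof.
move=> v0; have pi2 : 0 <= 2 * pi :> R by rewrite mulr_ge0 ?pi_ge0.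
rewrite (_ : Num.sqrt v * _ =
    npdf 0 1 t * expR ((1 - v^-1) / 2 * t ^+ 2)); last first.
  rewrite /npdf -[RHS]mulrA -expRD mulr1 (sqrtrM v)//.
  rewrite invfM mulrA mulrCA divff ?gt_eqF ?sqrtr_gt0// mulr1.
  congr (_ * expR _); first by rewrite mulr1.
  by rewrite !subr0; field; rewrite gt_eqF.
rewrite (_ : _ + _ = npdf 0 1 t * (1 + (1 - v^-1) / 2 * t ^+ 2)); last by ring.
by rewrite ler_wpM2l ?npdf_ge0// expR_ge1Dx.
Qed.

Let M_fin : M \is a fin_num.
Proof.
(* The tangent inequality at [v = 4], where the root is rational: [3 / 8] is [(1 - 1 / 4) / 2], and
   2 is the root of 4. Dropping the term [npdf 0 1 t] gives [16 / 3]. *)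
rewrite ge0_fin_numE//; apply: (@le_lt_trans _ _ (16 / 3)%:E); rewrite ?ltry//.
suff : ((3 / 8)%:E * M <= 2%:E)%E.
  rewrite -lee_pdivlMl//; first by move=> /le_trans; apply; rewrite lee_fin; lra.
rewrite /M -ge0_integralZl_EFin//; last 2 first.
- by move=> t _; rewrite lee_fin mulr_ge0 ?sqr_ge0 ?npdf_ge0.
- exact/measurable_EFinP.
apply: (@le_trans _ _ (\int[mu]_t (2%:E * (npdf 0 4 t)%:E))%E); last first.
  rewrite ge0_integralZl_EFin ?integral_npdf ?mule1//.
  + by move=> t _; rewrite lee_fin npdf_ge0.
  + by apply/measurable_EFinP; exact: measurable_npdf.
apply: ge0_le_integral => //.
- move=> t _; apply: mule_ge0; rewrite lee_fin; first lra.
  by rewrite mulr_ge0 ?sqr_ge0 ?npdf_ge0.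
- by apply: measurable_funeM; exact/measurable_EFinP.
- apply: measurable_funeM; apply/measurable_EFinP.
  exact: measurable_npdf.
- move=> t _; rewrite -EFinM lee_fin.
  have := @npdf_tangent 4 t; rewrite (_ : Num.sqrt 4 = 2); last first.
    by rewrite (_ : 4 = 2 ^+ 2) ?sqrtr_sqr ?ger0_norm//; ring.
  have := npdf_ge0 0 1 t; set u := t ^+ 2 * _; lra.
Qed.

Let M_tangent v : 0 < v -> (1 - v^-1) / 2 * fine M <= (v - 1) / 2.
Proof.
move=> v0.
have i1 : mu.-integrable setT (fun t => (npdf 0 1 t)%:E).
  by rewrite npdfE//; exact: integrable_normal_pdf.
have i2 : mu.-integrable setT (fun t => (npdf 0 v t)%:E).
  by rewrite npdfE//; exact: integrable_normal_pdf.
have iM : mu.-integrable setT (fun t => (t ^+ 2 * npdf 0 1 t)%:E).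
  apply/integrableP; split; first exact/measurable_EFinP.
  rewrite (_ : (\int[mu]_t _)%E = M); first by move: M_fin; rewrite ge0_fin_numE.
  by apply: eq_integral => t _; rewrite gee0_abs// lee_fin mulr_ge0 ?sqr_ge0 ?npdf_ge0.
have : (1 + ((1 - v^-1) / 2)%:E * M <= (Num.sqrt v)%:E)%E.
  rewrite -(@integral_npdf 0 1)// /M -integralZl//.
  rewrite -integralD//; last exact: integrableZl.
  rewrite -[leRHS]mule1 -(@integral_npdf 0 v)// -integralZl//.
  apply: le_integral => //.
  - by apply: integrableD => //; exact: integrableZl.
  - exact: integrableZl.
  - by move=> t _; rewrite -!EFinM -EFinD lee_fin npdf_tangent.
rewrite -[M]fineK// -EFinM -EFinD lee_fin.
(* This removes the root and leaves a bound whose two sides both vanish at [v = 1]. *)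
have : Num.sqrt v <= (1 + v) / 2.
  have e := sqr_sqrtr (ltW v0); have := sqr_ge0 (Num.sqrt v - 1).
  rewrite (_ : (Num.sqrt v - 1) ^+ 2 = Num.sqrt v ^+ 2 - 2 * Num.sqrt v + 1).
    by rewrite e; lra.
  ring.
lra.
Qed.

Lemma npdf_moment2 : (\int[mu]_t (t ^+ 2 * npdf 0 1 t)%:E = 1)%E.
Proof.
rewrite -/M -[M]fineK//; congr EFin; set k := fine M.
(* Multiplied by [2 * v], [M_tangent] reads [(v - 1) * k <= (v - 1) * v], and the sign of [v - 1]
   decides which way it bounds [k]. *)
have le1 v : 1 < v -> k <= v.
  move=> v1; have v0 : 0 < v by lra.
  have := M_tangent v0; rewrite -/k => h.
  have : (v - 1) * k <= (v - 1) * v.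
    have -> : (v - 1) * k = 2 * v * ((1 - v^-1) / 2 * k) by field; rewrite gt_eqF.
    have -> : (v - 1) * v = 2 * v * ((v - 1) / 2) by field.
    by rewrite ler_wpM2l// mulr_ge0// ltW.
  by rewrite ler_pM2l// subr_gt0.
have ge1 v : 0 < v < 1 -> v <= k.
  move=> /andP[v0 v1].
  have := M_tangent v0; rewrite -/k => h.
  have : (1 - v) * v <= (1 - v) * k.
    have -> : (1 - v) * k = - (2 * v * ((1 - v^-1) / 2 * k)).
      by field; rewrite gt_eqF.
    have -> : (1 - v) * v = - (2 * v * ((v - 1) / 2)) by field.
    by rewrite lerN2 ler_wpM2l// mulr_ge0// ltW.
  by rewrite ler_pM2l// subr_gt0.
(* If [k] were not 1, the midpoint of 1 and [k] would violate one of the two bounds. *)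
apply/eqP; rewrite eq_le; apply/andP; split; rewrite leNgt; apply/negP => k1.
- by have := @le1 ((1 + k) / 2); lra.
- have k0 : 0 <= k by exact: fine_ge0.
  by have := @ge1 ((1 + k) / 2); lra.
Qed.

(* The cross term is removed by averaging over [t |-> - t]. *)
Lemma npdf_affine_moment2 a s :
  (\int[mu]_t ((a + s * t) ^+ 2 * npdf 0 1 t)%:E = (a ^+ 2 + s ^+ 2)%:E)%E.
Proof.
pose g b t := ((b + s * t) ^+ 2 * npdf 0 1 t)%:E : \bar R.
have mg b : measurable_fun setT (g b).
  apply/measurable_EFinP; apply: measurable_funM; last exact: measurable_npdf.
  by apply: measurable_funX; apply: measurable_funD => //; exact: measurable_funM.
have g0 b t : (0 <= g b t)%E by rewrite lee_fin mulr_ge0 ?sqr_ge0 ?npdf_ge0.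
have mE c : measurable_fun setT (fun t : R => (c * npdf 0 1 t)%:E : \bar R).
  by apply/measurable_EFinP; apply: measurable_funM => //; exact: measurable_npdf.
have s2 : 0 <= 2 * s ^+ 2 by rewrite mulr_ge0 ?sqr_ge0.
have a2 : 0 <= 2 * a ^+ 2 by rewrite mulr_ge0 ?sqr_ge0.
have mgN : measurable_fun setT (fun t : R => g a (- t)).
  by apply: (measurableT_comp (mg a)); exact: oppr_measurable.
have J0 : (0 <= \int[mu]_t g a t)%E by exact: integral_ge0.
have JJ : (\int[mu]_t g a t + \int[mu]_t g a t = (2 * (a ^+ 2 + s ^+ 2))%:E)%E.
  rewrite -{2}(ge0_lebesgue_integralN (mg a))// -ge0_integralD//; last exact (mg a).
  transitivity (\int[mu]_t ((2 * a ^+ 2 * npdf 0 1 t)%:E +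
      (2 * s ^+ 2)%:E * (t ^+ 2 * npdf 0 1 t)%:E))%E.
    apply: eq_integral => t _; rewrite /g npdfN -!EFinM -!EFinD.
    by congr EFin; ring.
  rewrite ge0_integralD//; last 4 first.
  - by move=> t _; rewrite lee_fin mulr_ge0 ?npdf_ge0.
  - exact (mE (2 * a ^+ 2)).
  - move=> t _; apply: mule_ge0; rewrite lee_fin//.
    by rewrite mulr_ge0 ?sqr_ge0 ?npdf_ge0.
  - by apply: measurable_funeM; exact/measurable_EFinP.
  rewrite ge0_integralZl_EFin//; last 2 first.
  - by move=> t _; rewrite lee_fin mulr_ge0 ?sqr_ge0 ?npdf_ge0.
  - exact/measurable_EFinP.
  rewrite npdf_moment2 mule1.
  under eq_integral do rewrite EFinM.
  rewrite ge0_integralZl_EFin//; last 2 first.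
  - by move=> t _; rewrite lee_fin npdf_ge0.
  - by apply/measurable_EFinP; exact: measurable_npdf.
  by rewrite integral_npdf// mule1 -EFinD; congr EFin; ring.
(* The integral was not known to be finite; its double being a real number excludes infinite
   values. *)
move: JJ J0; case: (\int[mu]_t g a t)%E => [r| |]//.
by rewrite -EFinD => -[rr] _; congr EFin; lra.
Qed.

End gaussian_line.

(** * Positive semidefinite square roots of diagonal matrices *)

Section psd_sqrt.
Context {R : realType} {d : nat}.

(** This is uniqueness of the positive semidefinite root: [S] must equal the entrywise root [D] of
    the diagonal matrix [S *m S]. Since [S] commutes with its square, it commutes with [D], so
    [S *m S = D *m D] factors as [(S - D) *m (S + D) = 0]; positivity then forces every row of
    [S - D] to vanish. *)
Lemma psd_sqrt_diag (S : 'M[R]_d) :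
  psd_mx S -> is_diag_mx (S *m S) -> is_diag_mx S.
Proof.
move=> [ST Spsd] /is_diag_mxP SSd.
pose l i := (S *m S) i i.
have l0 i : 0 <= l i.
  rewrite /l mxE; apply: sumr_ge0 => j _.
  by rewrite -{1}ST mxE -expr2 sqr_ge0.
have SSE : S *m S = diag_mx (\row_i l i).
  apply/matrixP => i j; rewrite [RHS]mxE [X in _ = X *+ _]mxE.
  by case: eqVneq => [->|ij]; rewrite ?mulr1n ?mulr0n//; apply: SSd.
pose D := diag_mx (\row_i Num.sqrt (l i)).
have DT : D^T = D by rewrite tr_diag_mx.
have SlE i j : S i j * l j = l i * S i j.
  have : (S *m (S *m S)) i j = (S *m S *m S) i j by rewrite mulmxA.
  by rewrite SSE mul_mx_diag mul_diag_mx !mxE.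
have SDC : S *m D = D *m S.
  apply/matrixP => i j; rewrite mul_mx_diag mul_diag_mx !mxE.
  (* A nonzero entry [S i j] forces [l i = l j], hence equal roots. *)
  have [->|S0] := eqVneq (S i j) 0; first by rewrite mul0r mulr0.
  have /(mulfI S0) -> : S i j * l j = S i j * l i by rewrite SlE mulrC.
  by rewrite mulrC.
have DD : D *m D = S *m S.
  rewrite SSE mul_diag_mx; apply/matrixP => i j; rewrite !mxE.
  case: eqVneq => [->|ij]; last by rewrite !mulr0n mulr0.
  by rewrite !mulr1n -expr2 sqr_sqrtr.
have SD0 : (S - D) *m (S + D) = 0.
  by rewrite mulmxDr !mulmxBl SDC DD addrA subrK subrr.
suff -> : S = D by exact: diag_mx_is_diag.
apply/eqP; rewrite -subr_eq0; apply/eqP/row_matrixP => i; rewrite row0.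
set u := row i (S - D).
have uE : u = delta_mx 0 i *m (S - D) by rewrite -rowE.
have uSD0 : u *m (S + D) = 0 by rewrite uE -mulmxA SD0 mulmx0.
(* The forms of [S] and [D] at [u] are nonnegative with sum 0, so that of [D] vanishes, and being
   diagonal it vanishes term by term. *)
have uD0 : u *m D = 0.
  have uDu : (u *m D *m u^T) 0 0 = \sum_j u 0 j ^+ 2 * Num.sqrt (l j).
    rewrite mxE; apply: eq_bigr => j _.
    by rewrite mul_mx_diag !mxE expr2 mulrAC.
  have uDu0 : \sum_j u 0 j ^+ 2 * Num.sqrt (l j) = 0.
    apply/eqP; rewrite eq_le; apply/andP; split; last first.
      by apply: sumr_ge0 => j _; rewrite mulr_ge0 ?sqr_ge0 ?sqrtr_ge0.
    have : (u *m (S + D) *m u^T) 0 0 = 0 by rewrite uSD0 mul0mx mxE.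
    rewrite mulmxDr mulmxDl mxE uDu => /eqP; rewrite addrC addr_eq0 => /eqP ->.
    by rewrite oppr_le0 Spsd.
  apply/rowP => j; rewrite mul_mx_diag !mxE.
  have /eqP := uDu0; rewrite psumr_eq0; last first.
    by move=> k _; rewrite mulr_ge0 ?sqr_ge0 ?sqrtr_ge0.
  move=> /allP/(_ j); rewrite mem_index_enum => /(_ isT)/=.
  by rewrite mulf_eq0 sqrf_eq0 !mxE => /orP[|] /eqP ->; rewrite ?mul0r ?mulr0.
have uS0 : u *m S = 0.
  by have := uSD0; rewrite mulmxDr uD0 addr0.
(* [S - D] is symmetric, so [u^T] is one of its columns, while [u *m (S - D) = 0]. *)
have uu0 : u *m u^T = 0.
  rewrite {1}uE -[RHS]trmx0 -[LHS]trmxK; congr trmx.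
  rewrite !trmx_mul trmxK mulmxA.
  by rewrite linearB/= ST DT mulmxBr uD0 uS0 subr0 mul0mx.
apply/rowP => j; rewrite [RHS]mxE.
have /eqP : (u *m u^T) 0 0 = 0 by rewrite uu0 mxE.
rewrite mxE psumr_eq0 => [|k _]; last by rewrite [X in _ * X]mxE -expr2 sqr_ge0.
move=> /allP/(_ j); rewrite mem_index_enum => /(_ isT)/=.
by rewrite [X in _ * X]mxE -expr2 sqrf_eq0 => /eqP.
Qed.

End psd_sqrt.

(** * Contractions: measurability and the Lipschitz constant *)

Section euclidean_norm.
Context {R : realType} {d : nat}.
Implicit Types (x y : 'rV[R]_d) (T : 'rV[R]_d -> 'rV[R]_d).

Lemma enorm_ge0 x : 0 <= enorm x.
Proof. exact: sqrtr_ge0. Qed.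

Lemma enorm_sqr x : enorm x ^+ 2 = \sum_(i < d) x ord0 i ^+ 2.
Proof. by rewrite sqr_sqrtr// sumr_ge0// => i _; rewrite sqr_ge0. Qed.

Lemma ler_coord_enorm x i : `|x ord0 i| <= enorm x.
Proof.
rewrite -(@ler_pXn2r _ 2) ?nnegrE ?enorm_ge0//.
rewrite enorm_sqr real_normK ?num_real// (bigD1 i)//= lerDl.
by apply: sumr_ge0 => j _; rewrite sqr_ge0.
Qed.

Lemma enorm_le_sum x : enorm x <= \sum_(i < d) `|x ord0 i|.
Proof.
have sq (I : Type) (r : seq I) (F : I -> R) :
    \sum_(i <- r) F i ^+ 2 <= (\sum_(i <- r) `|F i|) ^+ 2.
  elim: r => [|i r IH]; first by rewrite !big_nil expr0n.
  rewrite !big_cons sqrrD real_normK ?num_real// -addrA lerD2l.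
  rewrite (le_trans IH)// lerDr mulrn_wge0// mulr_ge0//.
  by apply: sumr_ge0 => j _.
have s0 : 0 <= \sum_(i < d) `|x ord0 i| by apply: sumr_ge0 => i _.
by rewrite -(@ler_pXn2r _ 2) ?nnegrE ?enorm_ge0// enorm_sqr sq.
Qed.

(** The sigma-algebra is generated by the coordinates, so continuity does not give measurability
    directly. But [f] is the infimum, over rational points [q], of [f q] plus the l1 distance to
    [q], and these functions are explicit in the coordinates. *)
Lemma measurable_lipschitz_sum (f : 'rV[R]_d -> R) :
  (forall x y, `|f x - f y| <= \sum_(i < d) `|(x - y) ord0 i|) ->
  measurable_fun setT f.
Proof.
move=> fL; apply: (measurability _ (RGenInftyO.measurableE R)) => //.
move=> _ [_ [r ->] <-]; rewrite setTI.
pose F (q : 'rV[rat]_d) := [set x : 'rV[R]_d |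
  f (map_mx ratr q) + \sum_(i < d) `|x ord0 i - ratr (q ord0 i)| < r].
rewrite [X in measurable X](_ : _ = \bigcup_q F q).
  apply: countable_bigcupT_measurable => // q.
  rewrite (_ : F q = (fun x : 'rV[R]_d =>
      f (map_mx ratr q) + \sum_(i < d) `|x ord0 i - ratr (q ord0 i)|)
      @^-1` `]-oo, r[%classic); last first.
    by apply/seteqP; split=> x /=; rewrite in_itv.
  rewrite -[X in measurable X]setTI.
  have mF : measurable_fun setT (fun x : 'rV[R]_d =>
      f (map_mx ratr q) + \sum_(i < d) `|x ord0 i - ratr (q ord0 i)|).
    apply: measurable_funD => //; apply: measurable_sum => i.
    apply: measurableT_comp => //; apply: measurable_funD => //.
    exact: measurable_coord.
  by apply: mF => //; exact: measurable_itv.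
apply/seteqP; split=> x /=; rewrite in_itv/=.
(* A point [q] within [e] in each coordinate costs at most [d * e] twice, once for [f q - f x] and
   once for the distance. Using [d.+1] makes the bound strict and covers [d = 0]. *)
- move=> fxr; pose e := (r - f x) / (2 * d.+1%:R).
  have e0 : 0 < e by rewrite divr_gt0 ?subr_gt0// mulr_gt0.
  have /choice[q qP] i : exists q : rat, ratr q \in `]x ord0 i, x ord0 i + e[.
    by apply: rat_in_itvoo; rewrite ltrDl.
  exists (\row_i q i) => //=; rewrite /F/=.
  set s := \sum_(i < d) _.
  have se : s <= d%:R * e.
    have -> : d%:R * e = \sum_(i < d) e by rewrite sumr_const card_ord mulr_natl.
    apply: ler_sum => i _; rewrite mxE.
    by have := qP i; rewrite in_itv/= => /andP[h1 h2]; rewrite ltr0_norm; lra.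
  have : f (map_mx ratr (\row_i q i)) - f x <= s.
    apply: (le_trans (ler_norm _)); rewrite distrC (le_trans (fL _ _))//.
    by rewrite /s; apply: ler_sum => i _; rewrite !mxE.
  have : d.+1%:R * e = (r - f x) / 2.
    by rewrite /e; field; rewrite gt_eqF.
  rewrite -natr1; lra.
- move=> [q _]; rewrite /F/=.
  have := fL x (map_mx ratr q).
  rewrite (eq_bigr (fun i => `|x ord0 i - ratr (q ord0 i)|)); last first.
    by move=> i _; rewrite !mxE.
  have := ler_norm (f x - f (map_mx ratr q)); lra.
Qed.

Lemma measurable_contraction T : contraction_map T -> measurable_fun setT T.
Proof.
move=> T1; apply/measurable_fun_rVP => i; apply: measurable_lipschitz_sum => x y.
rewrite (le_trans _ (enorm_le_sum _))//.
have := T1 x y; rewrite mul1r; apply: le_trans.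
by have := ler_coord_enorm (T x - T y) i; rewrite !mxE.
Qed.

Lemma strong_contraction_contraction T : strong_contraction T -> contraction_map T.
Proof.
move=> sT x y; rewrite mul1r ler_wsqrtr//; apply: ler_sum => i _; rewrite !mxE.
rewrite -real_normK ?num_real// -[leRHS]real_normK ?num_real//.
by rewrite ler_pXn2r ?nnegrE.
Qed.

Let Lip_lb T : has_lbound [set k | 0 <= k /\ elipschitz k T].
Proof. by exists 0 => k []. Qed.

Lemma Lip_le1 T : contraction_map T -> Lip T <= 1.
Proof. by move=> T1; apply: ge_inf. Qed.

Lemma Lip_ge0 T : contraction_map T -> 0 <= Lip T.
Proof.
by move=> T1; apply: lb_le_inf; [exists 1|move=> k []].
Qed.

(** The infimum is attained: for distinct points the difference quotient is a lower bound of the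
    admissible constants, and 1 is one of them. *)
Lemma elipschitz_Lip T : contraction_map T -> elipschitz (Lip T) T.
Proof.
move=> T1 x y; have := enorm_ge0 (x - y); rewrite le_eqVlt => /predU1P[e0|e0].
  by have := T1 x y; rewrite -e0 !mulr0.
rewrite -ler_pdivrMr//; apply: lb_le_inf; first by exists 1.
by move=> k [_ kT]; rewrite ler_pdivrMr.
Qed.

(* The i-th coordinate of [T] depends only on the i-th coordinate of its
   argument, so [x] and [y] may be assumed to agree on the other ones. *)
Lemma strong_contraction_Lip T i x y : strong_contraction T ->
  `|T x ord0 i - T y ord0 i| <= Lip T * `|x ord0 i - y ord0 i|.
Proof.
move=> sT; have T1 := strong_contraction_contraction sT.
pose z := \row_j (if j == i then y ord0 i else x ord0 j).
have -> : T y ord0 i = T z ord0 i.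
  apply/eqP; rewrite -subr_eq0 -normr_le0; apply: le_trans (sT i y z) _.
  by rewrite mxE eqxx subrr normr0.
have -> : `|x ord0 i - y ord0 i| = enorm (x - z).
  rewrite /enorm (bigD1 i)//= big1 ?addr0 => [|j /negPf ji].
    by rewrite !mxE eqxx sqrtr_sqr.
  by rewrite !mxE ji subrr expr0n.
apply: le_trans (elipschitz_Lip T1 x z).
by have := ler_coord_enorm (T x - T z) i; rewrite !mxE.
Qed.

End euclidean_norm.

(** * Geometric means and Minkowski's inequality *)

Section geometric_mean.
Context {R : realType} {n : nat}.
Implicit Types (a b : 'I_n -> R).

(** For positive entries this is the n-th root of the product, in the form in which entropies
    produce it. *)
Definition gmean a : R := expR (n%:R^-1 * \sum_(i < n) ln (a i)).

Lemma gmean_gt0 a : 0 < gmean a.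
Proof. exact: expR_gt0. Qed.

Lemma gmean_le a b : (forall i, 0 < a i) -> (forall i, a i <= b i) ->
  gmean a <= gmean b.
Proof.
move=> a0 ab; rewrite ler_expR ler_wpM2l ?invr_ge0//; apply: ler_sum => i _.
by rewrite ler_ln ?posrE// (lt_le_trans (a0 i)).
Qed.

Lemma gmeanM a b : (forall i, 0 < a i) -> (forall i, 0 < b i) ->
  gmean (fun i => a i * b i) = gmean a * gmean b.
Proof.
move=> a0 b0; rewrite -expRD -mulrDr -big_split/=; congr (expR (_ * _)).
by apply: eq_bigr => i _; rewrite lnM ?posrE.
Qed.

Hypothesis n_gt0 : (0 < n)%N.
Let n0 : n%:R != 0 :> R. Proof. by rewrite pnatr_eq0 -lt0n. Qed.

Lemma gmean_cst (c : R) : 0 < c -> gmean (fun=> c) = c.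
Proof.
by move=> c0; rewrite /gmean sumr_const card_ord -(mulr_natl (ln c)) mulKf// lnK.
Qed.

(** Write [a i] as [gmean a * expR (ln (a i) - m)] and bound the exponential below by its tangent at
    0; the deviations [ln (a i) - m] add up to 0. *)
Lemma gmean_le_mean a : (forall i, 0 < a i) ->
  gmean a <= n%:R^-1 * \sum_(i < n) a i.
Proof.
move=> a0; set m := n%:R^-1 * \sum_(i < n) ln (a i).
have : \sum_(i < n) (gmean a * (1 + (ln (a i) - m))) <= \sum_(i < n) a i.
  apply: ler_sum => i _; apply: (@le_trans _ _ (gmean a * expR (ln (a i) - m))).
    by rewrite ler_wpM2l ?expR_ge1Dx// ltW// gmean_gt0.
  by rewrite -expRD -/m addrC subrK lnK ?posrE.
rewrite -mulr_sumr !big_split/= !sumr_const card_ord -(mulr_natl (- m)).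
rewrite mulrN [n%:R * m]mulVKf// subrr addr0 => h.
by rewrite mulrC ler_pdivlMr ?ltr0n.
Qed.

(** After division by [gmean c], the two terms are geometric means of [a / c] and [b / c], whose
    arithmetic means add up to 1. *)
Lemma gmean_superadditive a b : (forall i, 0 < a i) -> (forall i, 0 < b i) ->
  gmean a + gmean b <= gmean (fun i => a i + b i).
Proof.
move=> a0 b0; pose c i := a i + b i.
have c0 i : 0 < c i by rewrite addr_gt0.
have aE : gmean a = gmean (fun i => a i / c i) * gmean c.
  rewrite -gmeanM// => [|i]; last by rewrite divr_gt0.
  by congr gmean; apply/funext => i; rewrite divfK ?gt_eqF.
have bE : gmean b = gmean (fun i => b i / c i) * gmean c.
  rewrite -gmeanM// => [|i]; last by rewrite divr_gt0.
  by congr gmean; apply/funext => i; rewrite divfK ?gt_eqF.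
have ac i : 0 < a i / c i by rewrite divr_gt0.
have bc i : 0 < b i / c i by rewrite divr_gt0.
rewrite aE bE -mulrDl ler_piMl ?(ltW (gmean_gt0 _))//.
apply: le_trans (lerD (gmean_le_mean ac) (gmean_le_mean bc)) _.
rewrite -mulrDr -big_split/=.
rewrite (eq_bigr (fun=> 1)) => [|i _]; last first.
  by rewrite -mulrDl divff// gt_eqF ?addr_gt0.
by rewrite sumr_const card_ord mulVf.
Qed.

End geometric_mean.

(** * Measurability of sums and differences of random vectors *)

Lemma measurable_rVD {d1} {T1 : measurableType d1} {R : realType} n
    (f g : T1 -> 'rV[R]_n) :
  measurable_fun setT f -> measurable_fun setT g ->
  measurable_fun setT (fun x => f x + g x).
Proof.
move=> /measurable_fun_rVP mf /measurable_fun_rVP mg.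
apply/measurable_fun_rVP => i; under eq_fun do rewrite mxE.
exact: measurable_funD.
Qed.

Lemma measurable_rVB {d1} {T1 : measurableType d1} {R : realType} n
    (f g : T1 -> 'rV[R]_n) :
  measurable_fun setT f -> measurable_fun setT g ->
  measurable_fun setT (fun x => f x - g x).
Proof.
move=> /measurable_fun_rVP mf /measurable_fun_rVP mg.
apply/measurable_fun_rVP => i; under eq_fun do rewrite !mxE.
exact: measurable_funB.
Qed.

(** * Gaussian densities with diagonal covariance *)

Section gaussian_space.
Context {R : realType} {d : nat}.
Implicit Types (c x y w : 'rV[R]_d) (v : 'I_d -> R).

Definition gpdf c v y : R := \prod_(i < d) npdf (c ord0 i) (v i) (y ord0 i).

Lemma gpdf_ge0 c v y : 0 <= gpdf c v y.
Proof. by apply: prodr_ge0 => i _; exact: npdf_ge0. Qed.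

Lemma gpdf_gt0 c v y : (forall i, 0 < v i) -> 0 < gpdf c v y.
Proof. by move=> v0; apply: prodr_gt0 => i _; exact: npdf_gt0. Qed.

Lemma measurable_gpdf c v : measurable_fun setT (gpdf c v).
Proof.
apply: (@measurable_rV_prod _ d (fun i => npdf (c ord0 i) (v i))) => i.
exact: measurable_npdf.
Qed.

Lemma integral_gpdf c v : (forall i, 0 < v i) ->
  (\int[lebesgue_rV d]_y (gpdf c v y)%:E = 1)%E.
Proof.
move=> v0; rewrite (ge0_integral_lebesgue_rV_prod
    (g := fun i => npdf (c ord0 i) (v i))); last 2 first.
- by move=> i; exact: measurable_npdf.
- by move=> i t; exact: npdf_ge0.
by rewrite big1// => i _; rewrite integral_npdf.
Qed.

(** Squared Mahalanobis distance to [c] for the covariance with diagonal [v]. Its expectation is the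
    only quantity through which a law enters the entropy bound. *)
Definition sqdist c v y : R := \sum_(i < d) (y ord0 i - c ord0 i) ^+ 2 / v i.

Lemma ln_gpdf c v y : (forall i, 0 < v i) ->
  ln (gpdf c v y) = - (\sum_(i < d) ln (2 * pi * v i) + sqdist c v y) / 2.
Proof.
move=> v0; have -> : gpdf c v y =
    expR (\sum_(i < d) ln (npdf (c ord0 i) (v i) (y ord0 i))).
  by rewrite expR_sum; apply: eq_bigr => i _; rewrite lnK// posrE npdf_gt0.
rewrite expRK /sqdist -big_split/= -sumrN mulr_suml.
by apply: eq_bigr => i _; rewrite ln_npdf.
Qed.

Lemma std_gauss_pdfE w : std_gauss_pdf w = gpdf 0 (fun=> 1) w.
Proof.
rewrite /std_gauss_pdf /gpdf /npdf big_split/= prodr_const card_ord mulr1 exprVn.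
rewrite -expR_sum enorm_sqr; congr (_ * expR _).
rewrite -sumrN mulr_suml; apply: eq_bigr => i _.
by rewrite mxE subr0 mulr1.
Qed.

Lemma ge0_integral_gpdf_coord c v (i : 'I_d) (h : R -> R) :
  (forall j, 0 < v j) -> measurable_fun setT h -> (forall t, 0 <= h t) ->
  (\int[lebesgue_rV d]_y (h (y ord0 i) * gpdf c v y)%:E =
   \int[lebesgue_measure]_t (h t * npdf (c ord0 i) (v i) t)%:E)%E.
Proof.
move=> v0 mh h0.
(* [h] is absorbed into the i-th factor; the other factors integrate to 1. *)
pose g j t := (if j == i then h t else 1) * npdf (c ord0 j) (v j) t.
have gE y : h (y ord0 i) * gpdf c v y = \prod_(j < d) g j (y ord0 j).
  rewrite big_split/=; congr (_ * _); rewrite (bigD1 i)//= eqxx big1 ?mulr1//.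
  by move=> j /negPf ->.
under eq_integral do rewrite gE.
rewrite ge0_integral_lebesgue_rV_prod; last 2 first.
- move=> j; apply: measurable_funM; last exact: measurable_npdf.
  by case: (j == i).
- by move=> j t; rewrite mulr_ge0 ?npdf_ge0//; case: ifP.
rewrite (bigD1 i)//= big1 ?mule1 /g ?eqxx// => j /negPf ->.
by under eq_integral do rewrite mul1r; rewrite integral_npdf.
Qed.

End gaussian_space.

(** * Expectations under densities and under independence *)

Section random_vector_integrals.
Context {disp : measure_display} {Omega : measurableType disp} {R : realType}.
Variable P : probability Omega R.
Context {d : nat}.
Implicit Types X Y : {mfun Omega >-> 'rV[R]_d}.

Lemma ge0_integral_has_density Y f (F : 'rV[R]_d -> \bar R) :
  has_density P Y f -> measurable_fun setT F -> (forall y, 0 <= F y)%E ->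
  (\int[P]_w F (Y w) = \int[lebesgue_rV d]_y (F y * (f y)%:E))%E.
Proof.
move=> [mf f0 fE] mF F0; rewrite -(ge0_integral_distribution Y)//.
by apply: (@ge0_integral_density _ _ _ _ _ (lebesgue_rV d) _ id).
Qed.

(** The joint law agrees with the product of the marginals on rectangles, hence everywhere, and
    Tonelli applies. *)
Lemma ge0_integral_independent X Y (F : 'rV[R]_d * 'rV[R]_d -> \bar R) :
  independent P X Y -> measurable_fun setT F -> (forall p, 0 <= F p)%E ->
  (\int[P]_w F (X w, Y w) = \int[P]_w \int[distribution P Y]_y F (X w, y))%E.
Proof.
move=> XY mF F0.
have mXY : measurable_fun setT (fun w => (X w, Y w)) by exact: measurable_fun_pair.
pose m := measure_function_pushforward__canonical__measure_function_Measure P mXY.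
transitivity (\int[distribution P X \x distribution P Y]_p F p)%E.
  rewrite -[LHS](@ge0_integral_pushforward _ _ _ _ _ _ mXY P setT F)//.
  apply: eq_measure_integral => A mA _; apply/esym.
  by apply: (@product_measure_unique _ _ _ _ _ _ _ m).
rewrite fubini_tonelli1// (ge0_integral_distribution X)//.
- exact: measurable_fun_fubini_tonelli_F.
- by move=> x; apply: integral_ge0.
Qed.

End random_vector_integrals.

(** * Second moments and the density of a Gaussian plus standard noise *)

Section gaussian_vectors.
Context {disp : measure_display} {Omega : measurableType disp} {R : realType}.
Variable P : probability Omega R.
Context {d : nat}.
Variables (Z G : {mfun Omega >-> 'rV[R]_d}) (mu : 'rV[R]_d) (s : 'I_d -> R).
Local Notation phi := (gpdf 0 (fun=> 1) : 'rV[R]_d -> R).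
Hypothesis Z_density : has_density P Z phi.
Hypothesis G_law : forall A : set 'rV[R]_d, measurable A -> P (G @^-1` A) =
  (\int[lebesgue_rV d]_(w in (fun w => mu + w *m diag_mx (\row_i s i))%R @^-1` A)
     (phi w)%:E)%E.

Let phi_ge0 y : 0 <= phi y. Proof. exact: gpdf_ge0. Qed.

Let mphi : measurable_fun setT phi. Proof. exact: measurable_gpdf. Qed.

Let coordE w i : (mu + w *m diag_mx (\row_i s i)) ord0 i = mu ord0 i + s i * w ord0 i.
Proof. by rewrite mul_mx_diag !mxE mulrC. Qed.

Let maff : measurable_fun setT
  (fun w : 'rV[R]_d => mu + w *m diag_mx (\row_i s i)).
Proof.
apply/measurable_fun_rVP => i; under eq_fun do rewrite coordE.
by apply: measurable_funD => //; apply: measurable_funM => //; exact: measurable_coord.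
Qed.

Lemma ge0_integral_gaussian (F : 'rV[R]_d -> \bar R) :
  measurable_fun setT F -> (forall y, 0 <= F y)%E ->
  (\int[P]_w F (G w) = \int[lebesgue_rV d]_w
    (F (mu + w *m diag_mx (\row_i s i))%R * (phi w)%:E))%E.
Proof.
move=> mF F0; rewrite -(ge0_integral_distribution G)//.
by apply: (@ge0_integral_density _ _ _ _ _ (lebesgue_rV d) _ _ phi).
Qed.

Lemma gaussian_variance i :
  (\int[P]_w ((G w ord0 i - mu ord0 i) ^+ 2)%:E = (s i ^+ 2)%:E)%E.
Proof.
rewrite (ge0_integral_gaussian (F := fun x => ((x ord0 i - mu ord0 i) ^+ 2)%:E)).
- under eq_integral do rewrite coordE addrC addKr -EFinM.
  rewrite (ge0_integral_gpdf_coord 0 (v := fun=> 1) i (h := fun t => (s i * t) ^+ 2))//.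
  + under eq_integral do rewrite mxE -[s i * _]add0r.
    by rewrite npdf_affine_moment2 expr0n add0r.
  + by apply: measurable_funX; exact: measurable_funM.
  + by move=> t; rewrite sqr_ge0.
- apply/measurable_EFinP; apply: measurable_funX; apply: measurable_funD => //.
  exact: measurable_coord.
- by move=> y; rewrite lee_fin sqr_ge0.
Qed.

Hypothesis GZ_independent : independent P G Z.

Let ge0_integral_GZ (F : 'rV[R]_d * 'rV[R]_d -> \bar R) :
  measurable_fun setT F -> (forall p, 0 <= F p)%E ->
  (\int[P]_w F (G w, Z w) =
   \int[P]_w \int[lebesgue_rV d]_z (F (G w, z) * (phi z)%:E))%E.
Proof.
move=> mF F0; rewrite ge0_integral_independent//; apply: eq_integral => w _.
have mFw : measurable_fun setT (fun z => F (G w, z)).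
  by apply: (measurableT_comp mF); exact: measurable_pair1.
rewrite ge0_integral_distribution//.
exact: (ge0_integral_has_density (F := fun z => F (G w, z)) Z_density).
Qed.

(** With [G] frozen, averaging over the noise coordinate, centered of variance 1, adds exactly 1.
    Both sides may be infinite. *)
Lemma integral_sqr_add_gaussian (a : 'rV[R]_d -> R) i : measurable_fun setT a ->
  (\int[P]_w ((a (G w) + Z w ord0 i) ^+ 2)%:E =
   1 + \int[P]_w (a (G w) ^+ 2)%:E)%E.
Proof.
move=> ma.
rewrite (ge0_integral_GZ (F := fun p => ((a p.1 + p.2 ord0 i) ^+ 2)%:E)).
- transitivity (\int[P]_w (1 + (a (G w) ^+ 2)%:E))%E.
    apply: eq_integral => w _ /=; under eq_integral do rewrite -EFinM.
    rewrite (ge0_integral_gpdf_coord 0 (v := fun=> 1) i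
      (h := fun t => (a (G w) + t) ^+ 2))//.
    + under eq_integral do rewrite mxE -[X in _ + X]mul1r.
      by rewrite npdf_affine_moment2 expr1n EFinD addeC.
    + by apply: measurable_funX; exact: measurable_funD.
    + by move=> t; rewrite sqr_ge0.
  rewrite ge0_integralD//.
  + by rewrite integral_cst// mul1e [X in (X + _)%E = _]probability_setT.
  + by move=> w _; rewrite lee_fin sqr_ge0.
  + apply/measurable_EFinP; apply: measurable_funX.
    exact: (measurableT_comp ma).
- apply/measurable_EFinP; apply: measurable_funX; apply: measurable_funD.
    exact: (measurableT_comp ma).
  exact: (measurableT_comp (measurable_coord i)).
- by move=> p; rewrite lee_fin sqr_ge0.
Qed.

(** Since [Z] has a density, the sum has at [y] the density given by the expectation of
    [phi (y - G)], even for singular [G]. That expectation factors into one-dimensional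
    convolutions. *)
Lemma gaussian_add_density :
  has_density P (G \+ Z) (gpdf mu (fun i => 1 + s i ^+ 2)).
Proof.
split=> [|y|A mA]; [exact: measurable_gpdf|exact: gpdf_ge0|].
pose K (p : 'rV[R]_d * 'rV[R]_d) : \bar R := (\1_A p.2 * phi (p.2 - p.1))%:E.
have K0 p : (0 <= K p)%E by rewrite lee_fin mulr_ge0.
have mind : measurable_fun setT (\1_A : 'rV[R]_d -> R).
  exact: measurable_indic.
have mK : measurable_fun setT K.
  apply/measurable_EFinP; apply: measurable_funM.
    by apply: (measurableT_comp mind).
  by apply: (measurableT_comp mphi); exact: measurable_rVB.
have mGZ : measurable_fun setT (G \+ Z) by exact: measurable_rVD.
transitivity (\int[P]_w (\1_A (G w + Z w))%:E)%E.
  rewrite -[RHS]/(\int[P]_w (\1_((G \+ Z) @^-1` A) w)%:E)%E integral_indic//.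
    by rewrite setIT.
  by rewrite -[X in measurable X]setTI; exact: mGZ.
rewrite (ge0_integral_GZ (F := fun p => (\1_A (p.1 + p.2))%:E)); last 2 first.
- apply/measurable_EFinP/(measurableT_comp mind).
  exact: measurable_rVD.
- by move=> p; rewrite lee_fin.
(* Substitute [y = G w + z] in the inner integral, so that the indicator of [A] no longer involves
   [w]. *)
transitivity (\int[P]_w \int[lebesgue_rV d]_y K (G w, y))%E.
  apply: eq_integral => w _ /=.
  rewrite -(ge0_lebesgue_rV_integralD (G w) (F := fun y => K (G w, y)))//.
    by apply: eq_integral => z _; rewrite /K/= addrK [z + _]addrC EFinM.
  by apply: (measurableT_comp mK); exact: measurable_pair1.
rewrite (fubini_tonelli (fun p => K (G p.1, p.2)))//=; last first.
  apply: (measurableT_comp mK); apply: measurable_fun_pair => //.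
  exact: measurableT_comp.
rewrite [RHS]integral_mkcond; apply: eq_integral => y _.
rewrite epatch_indic /K/=.
under eq_integral do rewrite EFinM.
rewrite ge0_integralZl_EFin//; last 2 first.
- by move=> w _; rewrite lee_fin.
- apply/measurable_EFinP/(measurableT_comp mphi).
  by apply: measurable_rVB.
rewrite muleC; congr (_ * _)%E.
rewrite (ge0_integral_gaussian (F := fun x => (phi (y - x))%:E)); last 2 first.
- apply/measurable_EFinP/(measurableT_comp mphi).
  by apply: measurable_rVB.
- by move=> x; rewrite lee_fin.
pose g i t := npdf 0 1 (y ord0 i - mu ord0 i - s i * t) * npdf 0 1 t.
transitivity (\int[lebesgue_rV d]_w (\prod_(i < d) g i (w ord0 i))%:E)%E.
  apply: eq_integral => w _; rewrite -EFinM /gpdf -big_split/=; congr EFin.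
  apply: eq_bigr => i _; rewrite /g.
  rewrite (_ : (y - _) ord0 i = y ord0 i - mu ord0 i - s i * w ord0 i).
    by rewrite [(0 : 'rV[R]_d) _ _]mxE.
  by rewrite mxE [X in _ + X]mxE coordE opprD addrA.
rewrite ge0_integral_lebesgue_rV_prod; last 2 first.
- move=> i; apply: measurable_funM; last exact: measurable_npdf.
  apply: (measurableT_comp (measurable_npdf _ _)).
  by apply: measurable_funB => //; exact: measurable_funM.
- by move=> i t; rewrite mulr_ge0 ?npdf_ge0.
rewrite /gpdf (big_morph EFin EFinM erefl); apply: eq_bigr => i _.
by rewrite /g npdf_conv /npdf subr0.
Qed.

End gaussian_vectors.

(* Neither function need be integrable: the convention [+oo - oo = -oo] keeps
   the integral monotone. *)
Lemma le_integral_measurable {d} {T : measurableType d} {R : realType}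
    (mu : {measure set T -> \bar R}) (f g : T -> \bar R) :
  measurable_fun setT f -> measurable_fun setT g -> (forall x, f x <= g x)%E ->
  (\int[mu]_x f x <= \int[mu]_x g x)%E.
Proof.
move=> mf mg fg; rewrite integralE [leRHS]integralE; apply: leeB.
- apply: ge0_le_integral => //; try exact: measurable_funepos.
  by move=> x _; rewrite !funeposE ge_max !le_max fg lexx orbT.
- apply: ge0_le_integral => //; try exact: measurable_funeneg.
  by move=> x _; rewrite !funenegE ge_max !le_max leeN2 fg lexx orbT.
Qed.

(** * Gaussian bounds and values for entropy and entropy power *)

Section gaussian_entropy.
Context {disp : measure_display} {Omega : measurableType disp} {R : realType}.
Variable P : probability Omega R.
Context {d : nat}.
Variables (Y : {mfun Omega >-> 'rV[R]_d}) (c : 'rV[R]_d) (v : 'I_d -> R).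
Hypothesis v_gt0 : forall i, 0 < v i.
Local Notation lambda := (@lebesgue_rV R d).
Let K := \sum_(i < d) ln (2 * pi * v i).

(** The density inside [entropy] is an arbitrary choice, so later arguments must work for every
    density [f] of [Y]. *)
Lemma has_density_entropy : (exists f, has_density P Y f) ->
  exists2 f, has_density P Y f &
    entropy P Y = (- \int[lambda]_y (f y * ln (f y))%:E)%E.
Proof.
move=> exf; rewrite /entropy; case: pselect => // exf'.
by exists (projT1 (cid exf')) => //; exact: projT2 (cid exf').
Qed.

(** Positivity of [d] matters: for [d = 0] the factor [2 / d] is 0 and the power would be 1. *)
Lemma no_density_entropy_power : (0 < d)%N -> ~ (exists f, has_density P Y f) ->
  entropy_power P Y = 0%E.
Proof.
move=> d0 nf; rewrite /entropy_power /entropy; case: pselect => //= _.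
by rewrite mulrNy gtr0_sg ?divr_gt0 ?ltr0n// mul1e.
Qed.

Lemma integral_has_density f : has_density P Y f ->
  (\int[lambda]_y (f y)%:E = 1)%E.
Proof.
by move=> [_ _ fE]; rewrite -fE// preimage_setT probability_setT.
Qed.

Lemma integrable_has_density f : has_density P Y f ->
  lambda.-integrable setT (fun y => (f y)%:E).
Proof.
move=> Yf; have [mf f0 fE] := Yf; apply/integrableP; split.
  exact/measurable_EFinP.
rewrite (_ : (\int[lambda]_y _)%E = 1%E) ?ltry// -(integral_has_density Yf).
by apply: eq_integral => y _; rewrite gee0_abs// lee_fin.
Qed.

Lemma measurable_sqdist : measurable_fun setT (sqdist c v).
Proof.
apply: measurable_sum => i; apply: measurable_funM => //; apply: measurable_funX.
by apply: measurable_funB => //; exact: measurable_coord.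
Qed.

Lemma sqdist_ge0 y : 0 <= sqdist c v y.
Proof. by apply: sumr_ge0 => i _; rewrite divr_ge0 ?sqr_ge0// ltW. Qed.

Section cross_entropy.
Variables (f : 'rV[R]_d -> R) (m : R).
Hypothesis Yf : has_density P Y f.
Hypothesis Ym : (\int[P]_w (sqdist c v (Y w))%:E = m%:E)%E.

Let sqdist_f : (\int[lambda]_y (sqdist c v y * f y)%:E = m%:E)%E.
Proof.
rewrite -Ym (ge0_integral_has_density (F := fun y => (sqdist c v y)%:E) Yf)//.
- by apply/measurable_EFinP; exact: measurable_sqdist.
- by move=> y; rewrite lee_fin sqdist_ge0.
Qed.

Let integrable_sqdist_f :
  lambda.-integrable setT (fun y => (sqdist c v y * f y)%:E).
Proof.
have [mf f0 fE] := Yf; apply/integrableP; split.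
  by apply/measurable_EFinP; apply: measurable_funM => //; exact: measurable_sqdist.
rewrite (_ : (\int[lambda]_y _)%E = m%:E) ?ltry// -sqdist_f.
by apply: eq_integral => y _; rewrite gee0_abs// lee_fin mulr_ge0 ?sqdist_ge0.
Qed.

Let f_ln_gpdf y : (f y * ln (gpdf c v y))%:E =
  ((- K / 2)%:E * (f y)%:E + (- 2^-1)%:E * (sqdist c v y * f y)%:E)%E.
Proof. by rewrite ln_gpdf// -/K -!EFinM -EFinD; congr EFin; field. Qed.

(** The logarithm of a Gaussian density is affine in [sqdist], so a finite [m] gives integrability
    here, while [f ln f] itself may fail to be integrable. *)
Lemma integrable_cross_entropy :
  lambda.-integrable setT (fun y => (f y * ln (gpdf c v y))%:E).
Proof.
under eq_fun do rewrite f_ln_gpdf.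
apply: integrableD => //; apply: integrableZl => //.
exact: integrable_has_density.
Qed.

Lemma integral_cross_entropy :
  (\int[lambda]_y (f y * ln (gpdf c v y))%:E = (- (K + m) / 2)%:E)%E.
Proof.
have fi := integrable_has_density Yf.
under eq_integral do rewrite f_ln_gpdf.
rewrite integralD//; [|exact: integrableZl|exact: integrableZl].
rewrite !integralZl// integral_has_density// sqdist_f mule1 -EFinM -EFinD.
by congr EFin; field.
Qed.

End cross_entropy.

(* Gibbs' inequality: [f ln f >= f ln q + f - q] for the Gaussian density [q]. *)
Lemma entropy_le_gaussian m : (\int[P]_w (sqdist c v (Y w))%:E = m%:E)%E ->
  (entropy P Y <= ((K + m) / 2)%:E)%E.
Proof.
move=> Ym; have [exf|nf] := pselect (exists f, has_density P Y f); last first.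
  by rewrite /entropy; case: pselect => //= _; rewrite leNye.
have [f Yf ->] := has_density_entropy exf; have [mf f0 fE] := Yf.
rewrite leeNl -EFinN -mulNr -(integral_cross_entropy Yf Ym).
have qi : lambda.-integrable setT (fun y => (gpdf c v y)%:E).
  apply/integrableP; split; first by apply/measurable_EFinP; exact: measurable_gpdf.
  rewrite (_ : (\int[lambda]_y _)%E = 1%E) ?ltry// -(integral_gpdf c v_gt0).
  by apply: eq_integral => y _; rewrite gee0_abs// lee_fin gpdf_ge0.
have fi := integrable_has_density Yf.
have fqi := integrable_cross_entropy Yf Ym.
(* Both densities have mass 1, so adding [f - q] changes nothing, and the comparison becomes
   pointwise. *)
have -> : (\int[lambda]_y (f y * ln (gpdf c v y))%:E =
    \int[lambda]_y ((f y * ln (gpdf c v y))%:E + ((f y)%:E - (gpdf c v y)%:E)))%E.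
  rewrite integralD//; last exact: integrableB.
  rewrite integralB// (integral_has_density Yf).
  by rewrite integral_gpdf// subee// adde0.
apply: le_integral_measurable.
- apply: emeasurable_funD; first exact: measurable_int fqi.
  by apply: emeasurable_funB; [exact: measurable_int fi|exact: measurable_int qi].
- apply/measurable_EFinP; apply: measurable_funM => //.
  exact: (measurableT_comp (@measurable_ln R)).
move=> y; rewrite -EFinB -EFinD lee_fin.
have q0 := gpdf_gt0 c y v_gt0; set q := gpdf c v y in q0 *.
(* Where [f] vanishes the claim is [- q <= 0]; elsewhere it is [ln t <= t - 1] at [t = q / f],
   multiplied by [f]. *)
have := f0 y; rewrite le_eqVlt => /predU1P[<-|fy0].
  by rewrite !mul0r !add0r oppr_le0 ltW.
have : ln (q / f y) <= q / f y - 1.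
  have := @expR_ge1Dx R (ln (q / f y)); rewrite lnK ?posrE ?divr_gt0//.
  lra.
rewrite ln_div ?posrE// => /(ler_wpM2l (ltW fy0)).
rewrite (_ : f y * (q / f y - 1) = q - f y); last by field; rewrite gt_eqF.
rewrite mulrBr; lra.
Qed.

(** The chosen density equals the Gaussian one almost everywhere, having the same integral on every
    measurable set; the entropy is then the cross-entropy of the Gaussian with itself. *)
Lemma entropy_gaussian : has_density P Y (gpdf c v) ->
  (\int[P]_w (sqdist c v (Y w))%:E = d%:R%:E)%E ->
  entropy P Y = ((K + d%:R) / 2)%:E.
Proof.
move=> Yq Ym; have [f Yf ->] := has_density_entropy (ex_intro _ _ Yq).
have [mf f0 fE] := Yf; have [mq q0 qE] := Yq.
rewrite (_ : (\int[lambda]_y _)%E = (- (K + d%:R) / 2)%:E).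
  by rewrite -EFinN; congr EFin; field.
rewrite -(integral_cross_entropy Yq Ym).
have fq : ae_eq lambda setT (fun y => (f y)%:E) (fun y => (gpdf c v y)%:E).
  apply: integral_ae_eq => //; first exact: integrable_has_density.
    exact/measurable_EFinP.
  by move=> E _ mE; rewrite -fE// -qE.
apply: ae_eq_integral => //.
- apply/measurable_EFinP; apply: measurable_funM => //.
  exact: (measurableT_comp (@measurable_ln R)).
- apply/measurable_EFinP; apply: measurable_funM => //.
  exact: (measurableT_comp (@measurable_ln R)).
- by apply: filterS fq => y /(_ I) [->].
Qed.

Hypothesis d_gt0 : (0 < d)%N.

Let gaussian_power : expR (2 / d%:R * ((K + d%:R) / 2)) = 2 * pi * expR 1 * gmean v.
Proof.
have d0 : d%:R != 0 :> R by rewrite pnatr_eq0 -lt0n.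
have -> : 2 / d%:R * ((K + d%:R) / 2) = 1 + d%:R^-1 * K by field.
have pi2 : 0 < 2 * pi :> R by rewrite mulr_gt0 ?pi_gt0.
have /= := gmeanM (a := fun=> 2 * pi) (b := v) (fun=> pi2) v_gt0.
rewrite gmean_cst// expRD -/(gmean (fun i => 2 * pi * v i)) => ->.
by rewrite mulrCA mulrA.
Qed.

Lemma entropy_power_le_gaussian :
  (\int[P]_w (sqdist c v (Y w))%:E <= d%:R%:E)%E ->
  (entropy_power P Y <= (2 * pi * expR 1 * gmean v)%:E)%E.
Proof.
move=> Yd; have d0 : 0 < d%:R :> R by rewrite ltr0n.
have Y0 : (0 <= \int[P]_w (sqdist c v (Y w))%:E)%E.
  by apply: integral_ge0 => w _; rewrite lee_fin sqdist_ge0.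
have Yfin : (\int[P]_w (sqdist c v (Y w))%:E)%E \is a fin_num.
  by rewrite ge0_fin_numE// (le_lt_trans Yd)// ltry.
have Ym := esym (fineK Yfin); have := entropy_le_gaussian Ym.
move: Yd; rewrite Ym lee_fin; set m := fine _ => md h.
rewrite -gaussian_power -[leRHS]/(expeR (2 / d%:R * ((K + d%:R) / 2))%:E).
rewrite lee_expeR [leRHS]EFinM; apply: lee_wpmul2l.
  by rewrite lee_fin divr_ge0.
by apply: le_trans h _; rewrite lee_fin ler_pM2r// lerD2l.
Qed.

Lemma entropy_power_gaussian : has_density P Y (gpdf c v) ->
  (\int[P]_w (sqdist c v (Y w))%:E = d%:R%:E)%E ->
  entropy_power P Y = (2 * pi * expR 1 * gmean v)%:E.
Proof.
by move=> Yq Ym; rewrite /entropy_power entropy_gaussian// -EFinM/= gaussian_power.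
Qed.

End gaussian_entropy.

Lemma integral_sqdist {disp} {Omega : measurableType disp} {R : realType}
    (P : probability Omega R) {d} (Y : {mfun Omega >-> 'rV[R]_d}) c v :
  (forall i, 0 < v i) ->
  (\int[P]_w (sqdist c v (Y w))%:E =
   \sum_(i < d) \int[P]_w ((Y w ord0 i - c ord0 i) ^+ 2)%:E * (v i)^-1%:E)%E.
Proof.
move=> v0; have mY i : measurable_fun setT (fun w => (Y w ord0 i - c ord0 i) ^+ 2).
  apply: measurable_funX; apply: measurable_funB => //.
  exact: (measurableT_comp (measurable_coord i)).
under eq_integral do rewrite -sumEFin.
rewrite ge0_integral_sum//.
- apply: eq_bigr => i _; rewrite -ge0_integralZr//.
  + exact/measurable_EFinP.
  + by move=> w _; rewrite lee_fin sqr_ge0.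
  + by rewrite lee_fin invr_ge0 ltW.
- by move=> i; apply/measurable_EFinP; exact: measurable_funM.
- by move=> i w _; rewrite lee_fin divr_ge0 ?sqr_ge0// ltW.
Qed.

(** * The entropy power inequality under contractions *)

Section gaussian_contraction.
Context {disp : measure_display} {Omega : measurableType disp} {R : realType}.
Variable P : probability Omega R.
Context {d : nat}.
Implicit Types (X : {mfun Omega >-> 'rV[R]_d}) (mu : 'rV[R]_d) (s : 'I_d -> R).
Local Notation phi := (gpdf 0 (fun=> 1) : 'rV[R]_d -> R).
Local Notation affine mu s := (fun w : 'rV[R]_d => mu + w *m diag_mx (\row_i s i)).

Lemma gaussian_vector_diag X mu (Lambda : 'M[R]_d) :
  gaussian_vector P X mu Lambda -> is_diag_mx Lambda ->
  exists s, [/\ forall i, 0 <= s i, forall i, Lambda i i = s i ^+ 2 &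
    forall A : set 'rV[R]_d, measurable A -> P (X @^-1` A) =
      (\int[lebesgue_rV d]_(w in affine mu s @^-1` A) (phi w)%:E)%E].
Proof.
move=> [S [Spsd <- XE]] /(psd_sqrt_diag Spsd)/is_diag_mxP Sdiag.
have SE : S = diag_mx (\row_i S i i).
  apply/matrixP => i j; rewrite !mxE; case: eqVneq => [->|ij].
    by rewrite mulr1n.
  by rewrite mulr0n; apply: Sdiag.
exists (fun i => S i i); split=> [i|i|A mA].
- have := Spsd.2 (delta_mx 0 i); rewrite -rowE trmx_delta -colE.
  by rewrite !mxE.
- by rewrite {1 2}SE mul_diag_mx !mxE eqxx mulr1n expr2.
- by rewrite XE// -SE; apply: eq_integral => w _; rewrite std_gauss_pdfE.
Qed.

Lemma std_gaussian_vector_density X :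
  gaussian_vector P X 0 1%:M -> has_density P X phi.
Proof.
move=> Xg; have [s [s0 s1 XE]] := gaussian_vector_diag Xg (scalar_mx_is_diag _ _).
have affE : affine 0 s = id.
  apply/funext => w; rewrite add0r (_ : \row_i s i = const_mx 1).
    by rewrite diag_const_mx mulmx1.
  apply/rowP => i; rewrite !mxE; apply/eqP.
  by rewrite -(@eqrXn2 _ 2)// expr1n -s1 mxE eqxx.
split=> [|y|A mA]; first exact: measurable_gpdf.
  exact: gpdf_ge0.
by rewrite XE// affE preimage_id.
Qed.

(** The hyperplane of points with i-th coordinate [mu_i] carries all the mass of [X] but is
    Lebesgue-null, being a box with a one-point side. *)
Lemma degenerate_gaussian_no_density X mu s i :
  (forall A : set 'rV[R]_d, measurable A -> P (X @^-1` A) =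
    (\int[lebesgue_rV d]_(w in affine mu s @^-1` A) (phi w)%:E)%E) ->
  s i = 0 -> ~ exists f, has_density P X f.
Proof.
move=> XE si0 [f [mf f0 fE]]; pose A := [set x : 'rV[R]_d | x ord0 i = mu ord0 i].
have mA : measurable A.
  rewrite (_ : A = setT `&` (fun x : 'rV[R]_d => x ord0 i) @^-1` [set mu ord0 i]).
    by apply: measurable_coord => //; exact: measurable_set1.
  by rewrite setTI.
have A0 : lebesgue_rV d A = 0%E.
  pose B j : set (measurableTypeR R) := if j == i then [set mu ord0 i] else setT.
  rewrite (_ : A = [set x | forall j, B j (x ord0 j)]).
    rewrite lebesgue_rV_box => [|j]; last first.
      by rewrite /B; case: ifP => // _; exact: measurable_set1.
    by rewrite (bigD1 i)//= /B eqxx lebesgue_measure_set1 mul0e.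
  apply/seteqP; split=> x /=; rewrite /A/= => Ax.
    by move=> j; rewrite /B; case: eqP => [->|].
  by have := Ax i; rewrite /B eqxx.
have : P (X @^-1` A) = 1%E.
  rewrite XE// (_ : _ @^-1` _ = setT) ?integral_gpdf//.
  apply/seteqP; split=> // w _; rewrite /A/=.
  by rewrite mul_mx_diag !mxE si0 mulr0 addr0.
rewrite fE// null_set_integral//; first by move/eqP; rewrite eqe eq_sym oner_eq0.
by apply/measurable_EFinP; exact: measurable_funTS.
Qed.

Variables (Z G : {mfun Omega >-> 'rV[R]_d}) (mu : 'rV[R]_d) (s : 'I_d -> R).
Hypothesis d_gt0 : (0 < d)%N.
Hypothesis Z_density : has_density P Z phi.
Hypothesis G_law : forall A : set 'rV[R]_d, measurable A -> P (G @^-1` A) =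
  (\int[lebesgue_rV d]_(w in affine mu s @^-1` A) (phi w)%:E)%E.
Hypothesis GZ_independent : independent P G Z.

Let sum1 : (\sum_(i < d) 1)%E = d%:R%:E :> \bar R.
Proof. by rewrite sumEFin sumr_const card_ord. Qed.

Let e2pi_ge0 : 0 <= 2 * pi * expR 1 :> R.
Proof. by rewrite !mulr_ge0 ?pi_ge0 ?expR_ge0. Qed.

Let entropy_power_GZ : entropy_power P (G \+ Z) =
  (2 * pi * expR 1 * gmean (fun i => 1 + s i ^+ 2))%:E.
Proof.
have v0 i : 0 < 1 + s i ^+ 2 by rewrite ltr_wpDr// sqr_ge0.
have mGZ : measurable_fun setT (G \+ Z) by exact: measurable_rVD.
pose Y : {mfun Omega >-> 'rV[R]_d} :=
  HB.pack (G \+ Z) (isMeasurableFun.Build _ _ _ _ _ mGZ).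
apply: (@entropy_power_gaussian _ _ _ _ _ Y mu) => //.
  exact: gaussian_add_density.
rewrite integral_sqdist// -sum1; apply: eq_bigr => i _.
rewrite -(_ : (1 + s i ^+ 2)%:E * (1 + s i ^+ 2)^-1%:E = 1)%E; last first.
  by rewrite -EFinM divff// gt_eqF.
congr (_ * _)%E; rewrite EFinD -(gaussian_variance G_law i).
rewrite -(integral_sqr_add_gaussian Z_density GZ_independent
  (a := fun x => x ord0 i - mu ord0 i) i).
  by apply: eq_integral => w _; rewrite mxE addrAC.
by apply: measurable_funB => //; exact: measurable_coord.
Qed.

Let entropy_power_G : (forall i, s i != 0) ->
  (entropy_power P G <= (2 * pi * expR 1 * gmean (fun i => s i ^+ 2))%:E)%E.
Proof.
move=> s0; have v0 i : 0 < s i ^+ 2 by rewrite exprn_even_gt0//= s0.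
apply: (@entropy_power_le_gaussian _ _ _ _ _ _ mu) => //.
rewrite integral_sqdist// -sum1; apply: lee_sum => i _.
by rewrite (gaussian_variance G_law) -EFinM divff// gt_eqF.
Qed.

(** Common core of the two cases, which differ only in how they prove the weighted second-moment
    bound assumed here. *)
Lemma entropy_power_contraction (T : 'rV[R]_d -> 'rV[R]_d) : contraction_map T ->
  (\sum_(i < d) (1 + \int[P]_w ((T (G w) ord0 i - T mu ord0 i) ^+ 2)%:E) *
     (1 + Lip T ^+ 2 * s i ^+ 2)^-1%:E <= d%:R%:E)%E ->
  (entropy_power P ((T \o G) \+ Z)%R + (1 - Lip T ^+ 2)%:E * entropy_power P G <=
   entropy_power P (G \+ Z)%R)%E.
Proof.
move=> T1 Tvar; have mT := measurable_contraction T1.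
set L := Lip T in Tvar *; have L0 : 0 <= L := Lip_ge0 T1.
have L1 : L <= 1 := Lip_le1 T1.
have LL1 : L ^+ 2 <= 1 by rewrite expr_le1.
have v0 i : 0 < 1 + L ^+ 2 * s i ^+ 2.
  by rewrite ltr_wpDr// mulr_ge0 ?sqr_ge0.
have mY : measurable_fun setT ((T \o G) \+ Z)%R.
  by apply: measurable_rVD => //; exact: (measurableT_comp mT).
pose Y : {mfun Omega >-> 'rV[R]_d} :=
  HB.pack ((T \o G) \+ Z)%R (isMeasurableFun.Build _ _ _ _ _ mY).
have YN : (entropy_power P Y <=
    (2 * pi * expR 1 * gmean (fun i => 1 + L ^+ 2 * s i ^+ 2))%:E)%E.
  apply: (@entropy_power_le_gaussian _ _ _ _ _ _ (T mu)) => //.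
  apply: le_trans Tvar; rewrite integral_sqdist//; apply: lee_sum => i _.
  rewrite -(integral_sqr_add_gaussian Z_density GZ_independent
    (a := fun x => T x ord0 i - T mu ord0 i) i).
    rewrite le_eqVlt; apply/orP; left; apply/eqP; congr (_ * _)%E.
    by apply: eq_integral => w _; rewrite mxE addrAC.
  apply: measurable_funB => //.
  exact: (measurableT_comp (measurable_coord i) mT).
apply: le_trans (leeD2r _ YN) _; rewrite entropy_power_GZ.
(* This settles the cases where the term in [N(G)] vanishes, [s i = 0] for some [i] or [L ^+ 2 = 1];
   there Minkowski's inequality would meet zero entries. *)
have mono : gmean (fun i => 1 + L ^+ 2 * s i ^+ 2) <= gmean (fun i => 1 + s i ^+ 2).
  by apply: gmean_le => // i; rewrite lerD2l ler_piMl ?sqr_ge0.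
have [[i si0]|s_neq0] := pselect (exists i, s i = 0).
  rewrite (@no_density_entropy_power _ _ _ _ _ G)//; last first.
    exact: (degenerate_gaussian_no_density G_law si0).
  by rewrite mule0 adde0 lee_fin ler_wpM2l.
have s0 i : s i != 0 by apply/eqP => si; apply: s_neq0; exists i.
have [L1E|L1'] := eqVneq (L ^+ 2) 1.
  have -> : 1 - L ^+ 2 = 0 by rewrite L1E subrr.
  by rewrite mul0e adde0 lee_fin ler_wpM2l.
have L2lt : 0 < 1 - L ^+ 2 by rewrite subr_gt0 lt_neqAle L1' LL1.
apply: le_trans (leeD2l _ (lee_wpmul2l _ (entropy_power_G s0))) _.
  by rewrite lee_fin ltW.
rewrite -EFinM -EFinD lee_fin mulrCA -mulrDr ler_wpM2l//.
have ss i : 0 < s i ^+ 2 by rewrite exprn_even_gt0//= s0.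
(* The factor [1 - L ^+ 2] is moved inside the geometric mean as a constant family. *)
rewrite -[X in _ + X * _](gmean_cst d_gt0 L2lt) -gmeanM//.
apply: le_trans (gmean_superadditive d_gt0 v0 _) _.
  by move=> i; rewrite mulr_gt0.
rewrite le_eqVlt; apply/orP; left; apply/eqP; congr gmean.
by apply/funext => i; ring.
Qed.

Let mcoord (T : 'rV[R]_d -> 'rV[R]_d) i : measurable_fun setT T ->
  measurable_fun setT (fun w => ((T (G w) ord0 i - T mu ord0 i) ^+ 2)%:E : \bar R).
Proof.
move=> mT; apply/measurable_EFinP; apply: measurable_funX.
apply: measurable_funB => //; apply: (measurableT_comp (measurable_coord i)).
exact: (measurableT_comp mT).
Qed.

Let mcoordG i : measurable_fun setT
  (fun w => ((G w ord0 i - mu ord0 i) ^+ 2)%:E : \bar R).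
Proof. exact: (@mcoord id). Qed.

Let sqr_coord_ge0 (x : R) : (0 <= (x ^+ 2)%:E)%E.
Proof. by rewrite lee_fin sqr_ge0. Qed.

(** Coordinatewise control by [Lip T] makes each of the [d] weighted terms at most 1. *)
Lemma entropy_power_strong_contraction (T : 'rV[R]_d -> 'rV[R]_d) :
  strong_contraction T ->
  (entropy_power P ((T \o G) \+ Z)%R + (1 - Lip T ^+ 2)%:E * entropy_power P G <=
   entropy_power P (G \+ Z)%R)%E.
Proof.
move=> sT; have T1 := strong_contraction_contraction sT.
have mT := measurable_contraction T1.
apply: entropy_power_contraction => //; rewrite -sum1; apply: lee_sum => i _.
have v0 : 0 < 1 + Lip T ^+ 2 * s i ^+ 2.
  by rewrite ltr_wpDr// mulr_ge0 ?sqr_ge0.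
rewrite [leRHS](_ : _ =
    ((1 + Lip T ^+ 2 * s i ^+ 2)%:E * (1 + Lip T ^+ 2 * s i ^+ 2)^-1%:E)%E);
  last by rewrite -EFinM divff// gt_eqF.
apply: lee_wpmul2r; first by rewrite lee_fin invr_ge0 ltW.
rewrite EFinD; apply: leeD2l; rewrite EFinM -(gaussian_variance G_law i).
rewrite -ge0_integralZl_EFin ?sqr_ge0//.
apply: ge0_le_integral => //.
- exact: mcoord.
- by apply: measurable_funeM; exact: mcoordG.
move=> w _; rewrite -EFinM lee_fin -exprMn.
rewrite -[leLHS]real_normK ?num_real// -[leRHS]real_normK ?num_real//.
rewrite ler_pXn2r ?nnegrE// normrM (ger0_norm (Lip_ge0 T1)).
exact: strong_contraction_Lip.
Qed.

(** All weights equal [b^-1] and factor out, leaving the expected squared Euclidean norm of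
    [T (G) - T mu], which the Lipschitz bound controls. *)
Lemma entropy_power_isotropic_contraction (alpha : R) (T : 'rV[R]_d -> 'rV[R]_d) :
  (forall i, s i ^+ 2 = alpha) -> contraction_map T ->
  (entropy_power P ((T \o G) \+ Z)%R + (1 - Lip T ^+ 2)%:E * entropy_power P G <=
   entropy_power P (G \+ Z)%R)%E.
Proof.
move=> sE T1; have mT := measurable_contraction T1.
apply: entropy_power_contraction => //.
have alpha0 : 0 <= alpha by rewrite -(sE (Ordinal d_gt0)) sqr_ge0.
set b := 1 + Lip T ^+ 2 * alpha.
have b0 : 0 < b by rewrite ltr_wpDr// mulr_ge0 ?sqr_ge0.
under eq_bigr do rewrite sE -/b.
rewrite -ge0_sume_distrl => [|i _]; last by rewrite adde_ge0// integral_ge0.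
rewrite (_ : d%:R = d%:R * b / b); last by rewrite mulfK// gt_eqF.
rewrite EFinM; apply: lee_wpmul2r; first by rewrite lee_fin invr_ge0 ltW.
rewrite big_split/= sum1 /b mulrDr mulr1 EFinD; apply: leeD2l.
rewrite -ge0_integral_sum//; last by move=> i; exact: mcoord.
rewrite (_ : (d%:R * (Lip T ^+ 2 * alpha))%:E = (Lip T ^+ 2)%:E *
    \int[P]_w \sum_(i < d) ((G w ord0 i - mu ord0 i) ^+ 2)%:E)%E; last first.
  rewrite ge0_integral_sum//.
  under [X in _ = (_ * X)%E]eq_bigr do rewrite (gaussian_variance G_law) sE.
  by rewrite sumEFin sumr_const card_ord -EFinM -(mulr_natl alpha) mulrCA.
rewrite -ge0_integralZl_EFin ?sqr_ge0//; last 2 first.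
- by move=> w _; apply: sume_ge0.
- by apply: emeasurable_sum => i; exact: mcoordG.
apply: ge0_le_integral => //.
- by move=> w _; apply: sume_ge0.
- by apply: emeasurable_sum => i; exact: mcoord.
- apply: measurable_funeM; apply: emeasurable_sum => i; exact: mcoordG.
move=> w _; rewrite !sumEFin -EFinM lee_fin.
have : enorm (T (G w) - T mu) ^+ 2 <= (Lip T * enorm (G w - mu)) ^+ 2.
  by rewrite ler_pXn2r ?nnegrE ?mulr_ge0 ?Lip_ge0 ?enorm_ge0// elipschitz_Lip.
rewrite exprMn !enorm_sqr.
under eq_bigr do rewrite !mxE.
by under [X in _ <= _ * X]eq_bigr do rewrite !mxE.
Qed.

End gaussian_contraction.

Theorem theorem3p3 (R : realType) (disp : measure_display)
    (Omega : measurableType disp) (P : probability Omega R)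
    (d : nat) (d_gt0 : (0 < d)%N)
    (Z G : {mfun Omega >-> 'rV[R]_d})
    (mu : 'rV[R]_d) (Lambda : 'M[R]_d)
    (Z_gaussian : gaussian_vector P Z 0 1%:M)
    (G_gaussian : gaussian_vector P G mu Lambda)
    (Lambda_diag : is_diag_mx Lambda)
    (GZ_independent : independent P G Z) :
  (forall T : 'rV[R]_d -> 'rV[R]_d, strong_contraction T ->
     (entropy_power P (G \+ Z)%R >=
      entropy_power P ((T \o G) \+ Z)%R +
        (1 - Lip T ^+ 2)%:E * entropy_power P G)%E) /\
  ((exists2 alpha : R, 0 < alpha & Lambda = alpha%:M) ->
   forall T : 'rV[R]_d -> 'rV[R]_d, contraction_map T ->
     (entropy_power P (G \+ Z)%R >=
      entropy_power P ((T \o G) \+ Z)%R +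
        (1 - Lip T ^+ 2)%:E * entropy_power P G)%E).
Proof.
have Zd := std_gaussian_vector_density Z_gaussian.
have [s [s0 sE G_law]] := gaussian_vector_diag G_gaussian Lambda_diag.
split=> [T sT|[alpha alpha_gt0 LambdaE] T T1].
  exact: (entropy_power_strong_contraction d_gt0 Zd G_law).
apply: (entropy_power_isotropic_contraction d_gt0 Zd G_law GZ_independent) => //.
by move=> i; rewrite -sE LambdaE mxE eqxx.
Qed.
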